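(* There exists an absolute constant $c>0$ such that the following holds. Let $n\geq1$ and let $X$ be a random variable taking values in $\{0,\ldots,n\}$ with $\mathbb{P}(X=0)\,\mathbb{P}(X=n)>0$ and probability generating function $f_X$. Let $\delta>0$ and $R\geq1$. If all zeros $\zeta\in\mathbb{C}$ of $f_X$ satisfy $|\arg(\zeta)|\geq\delta$ and $R^{-1}\leq|\zeta|\leq R$, then $$\max_{y}\,\mathbb{P}(X=y)\leq c\,\delta^{-1}R^{\pi/\delta}\,n^{-1/2}.$$
   Context: For a random variable $X$ with values in $\{0,\ldots,n\}$, its probability generating function is the polynomial $f_X(z)=\sum_{k=0}^n\mathbb{P}(X=k)z^k$, $z\in\mathbb{C}$. For $z\in\mathbb{C}\setminus\{0\}$ write $z=re^{i\theta}$ with $r>0$ and $\theta\in[-\pi,\pi]$; then $\arg(z)=\theta$ (so $|\arg(z)|\in[0,\pi]$ is well defined). *)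

(* Defs.v *)
From HB Require Import structures.
From mathcomp Require Import all_boot all_order all_algebra.
From mathcomp Require Import all_classical all_reals all_analysis.
From mathcomp Require Import complex.

Set Implicit Arguments.
Unset Strict Implicit.
Unset Printing Implicit Defensive.

Import Order.TTheory GRing.Theory Num.Theory.
Import numFieldNormedType.Exports.

Local Open Scope classical_set_scope.
Local Open Scope ring_scope.
Local Open Scope complex_scope.

Definition pgf d (T : measurableType d) (R : realType) (P : probability T R)
    (X : {RV P >-> R}) (n : nat) : {poly R[i]} :=
  \poly_(k < n.+1) (pmf X k%:R)%:C.

(* arg is a relation because the closed range [-pi, pi] gives a negative real *)
(* both arguments pi and -pi; only `|t| is determined by z, see               *)
(* is_arg_norm_unique below.                                                  *)
Definition is_arg (R : realType) (z : R[i]) (t : R) : Prop :=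
  - pi <= t <= pi /\ exists2 r : R, 0 < r & z = r%:C * (cos t +i* sin t).

Lemma is_arg_exists (R : realType) (z : R[i]) :
  z != 0 -> exists t, is_arg z t.
Proof.
case: z => a b z0; pose r := Num.sqrt (a ^+ 2 + b ^+ 2).
have s0 : 0 < a ^+ 2 + b ^+ 2.
  rewrite lt_neqAle addr_ge0 ?sqr_ge0// andbT eq_sym.
  apply: contra z0; rewrite paddr_eq0 ?sqr_ge0// !sqrf_eq0.
  by move=> /andP[/eqP-> /eqP->].
have r0 : 0 < r by rewrite sqrtr_gt0.
have rE : r ^+ 2 = a ^+ 2 + b ^+ 2 by rewrite sqr_sqrtr// ltW.
have ab1 : (a / r) ^+ 2 + (b / r) ^+ 2 = 1.
  by rewrite !expr_div_n -mulrDl -rE divff// sqrf_eq0 gt_eqF.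
have a1 : -1 <= a / r <= 1.
  by rewrite -ler_norml -(@ler_sqr _ _ 1) ?nnegrE// real_normK ?num_real// expr1n -ab1 lerDl sqr_ge0.
have sE : Num.sqrt (1 - (a / r) ^+ 2) = `|b / r|.
  by rewrite -ab1 addrC addKr sqrtr_sqr.
have rb u : r * (u / r) = u by rewrite mulrC divfK// gt_eqF.
have [b0|b0] := leP 0 b.
- exists (acos (a / r)); split.
    by rewrite acos_lepi// andbT (le_trans _ (acos_ge0 _))// oppr_le0 pi_ge0.
  exists r => //; rewrite acosK ?in_itv//= sin_acos// sE ger0_norm ?divr_ge0// 1?ltW//.
  by apply/eqP; rewrite eq_complex /= !mul0r subr0 addr0 !rb !eqxx.
- exists (- acos (a / r)); split.
    by rewrite lerN2 acos_lepi//= (le_trans _ (pi_ge0 _))// oppr_le0 acos_ge0.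
  exists r => //; rewrite cosN sinN acosK ?in_itv//= sin_acos// sE.
  rewrite ler0_norm ?opprK ?ler_pdivrMr ?mul0r 1?ltW//.
  by apply/eqP; rewrite eq_complex /= !mul0r subr0 addr0 !rb !eqxx.
Qed.

Lemma is_arg_norm_unique (R : realType) (z : R[i]) (t u : R) :
  is_arg z t -> is_arg z u -> `|t| = `|u|.
Proof.
move=> [tpi [r r0 zr]] [upi [s s0 zs]].
have n2 v w : (w * cos v) ^+ 2 + (w * sin v) ^+ 2 = w ^+ 2 :> R.
  by rewrite !exprMn -mulrDr cos2Dsin2 mulr1.
have : r%:C * (cos t +i* sin t) = s%:C * (cos u +i* sin u) by rewrite -zr.
move=> /eqP; rewrite eq_complex /= !mul0r !subr0 !addr0 => /andP[/eqP e1 /eqP e2].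
have rs : r = s.
  by apply/eqP; rewrite -(@eqrXn2 _ 2) ?ltW//; rewrite -(n2 t r) -(n2 u s) e1 e2.
move: tpi upi; rewrite -!ler_norml => tpi upi.
apply: cos_inj; rewrite ?in_itv /= ?normr_ge0//.
have cn (v : R) : cos `|v| = cos v by case: (ger0P v) => _; rewrite ?cosN.
by rewrite !cn; apply: (mulfI (lt0r_neq0 r0)); rewrite {2}rs.
Qed.

(* Main.v *)
Require Import Defs.
From HB Require Import structures.
From mathcomp Require Import all_boot all_order all_algebra.
From mathcomp Require Import all_classical all_reals all_analysis.
From mathcomp Require Import complex ring lra.

(** Let f be the generating function, g(w) = f(e^w), a = delta/2 and
    mu(w) = g'(w)/g(w).  No zero of f has its argument in ]-2a, 2a[, so mu is
    holomorphic on |Im w| < 2a; it is real on the real axis, where mu(x) is the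
    mean of the law with weights P(X = k) e^(kx).  Along the imaginary axis
        d/dy |g(iy)|^2 = - 2 |g(iy)|^2 Im mu(iy),
    so a lower bound Im mu(iy) >= A y makes the characteristic function decay
    like exp(- A y^2 / 2), and a kernel argument turns this into a bound on the
    point probabilities.  Everything rests on bounding Im mu(iy) from below.

    Nonnegativity of the coefficients enters through |g(x + 2ia)| <= g(x).  On
    the strip a < Im w < 2a the quotient g(w) / g(w - 2ia) has modulus 1 on the
    lower edge (w - 2ia is then the conjugate of w), at most 1 on the upper edge,
    and tends to 1 at both ends.  By the maximum principle
    |g(x + i(a + t))| <= |g(x + i(a - t))|, and differentiating at t = 0 gives
    Im mu >= 0 on the line Im w = a ([epoly_le_reflect], [Im_mu_top]).

    In the variable u = e^(pi w / a), which maps 0 < Im w < a onto the upper half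
    plane, mu is thus a Pick function that is real on the positive axis.  Subtract
    from mu the real combination of 1 and u - 1/u that agrees with it at w = l and
    w = -l, and divide by 2 cosh(pi l / a) - u - 1/u.  The quotient is real on the
    lower edge of the strip, has nonnegative imaginary part on the upper edge, and
    imaginary part tending to 0 at the ends; so its imaginary part is nonnegative
    inside.  At w = iy this is [strip_interpolation]:
        Im mu(iy) >= sin(pi y / a) (mu(l) - mu(-l)) / (2 sinh(pi l / a)).

    With l = ln rho + delta, each zero contributes at least
    (e^delta - 1) / (e^delta + 1) to mu(l) - mu(-l) ([mu_spread]), while
    2 sinh(pi l / a) <= rho^(2 pi / delta) e^(2 pi): this is where the exponent of
    rho comes from.  Hence Im mu(iy) >= A y for 0 < y <= delta/8, where A is a
    constant times n rho^(- 2 pi / delta) ([Im_mu_lower], [epoly_decay]).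

    Finally, since the Fejer kernel is nonnegative, P(X = y) is at most the
    average of |g| over the points i (j - k) h with 0 <= j, k < N
    ([coef_le_fejer]).  For h = delta / (8 N) and N of the order of
    delta sqrt A these averages are dominated by a geometric series, whence
    P(X = y) <= C / (delta sqrt A) ([coef_gauss_bound]).

    The maximum principle is needed only for functions that are twice complex
    differentiable, where it follows from the second-derivative test applied in
    the horizontal and vertical directions ([strip_maximum]). *)

Set Implicit Arguments.
Unset Strict Implicit.
Unset Printing Implicit Defensive.
Import Order.TTheory GRing.Theory Num.Theory.
Import numFieldNormedType.Exports.
Local Open Scope classical_set_scope.
Local Open Scope ring_scope.
Local Open Scope complex_scope.

(** * The complex plane as a normed space over itself *)

(** Gives R[i] the topology and norm of the regular module R[i]^o, so that complex
    derivatives are directional derivatives over the field R[i] itself. *)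
HB.instance Definition _ (R : rcfType) := NormedModule.copy R[i] R[i]^o.

Section ComplexTopology.
Variable R : realType.
Implicit Types (z w h d e : R[i]) (F G : R[i] -> R[i]).

Lemma real_complexD (x y : R) : (x + y)%:C = x%:C + y%:C.
Proof. exact: (rmorphD (real_complex R)). Qed.

Lemma real_complexB (x y : R) : (x - y)%:C = x%:C - y%:C.
Proof. exact: (rmorphB (real_complex R)). Qed.

Lemma real_complexN (x : R) : (- x)%:C = - x%:C.
Proof. exact: (rmorphN (real_complex R)). Qed.

Lemma real_complexM (x y : R) : (x * y)%:C = x%:C * y%:C.
Proof. exact: (rmorphM (real_complex R)). Qed.

Lemma real_complexV (x : R) : (x^-1)%:C = (x%:C)^-1.
Proof. exact: (fmorphV (real_complex R)). Qed.

(** The modulus as a real number: the norm of R[i] takes values in R[i], which is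
    inconvenient for real estimates. *)
Definition cabs z : R := Num.sqrt ((complex.Re z) ^+ 2 + (complex.Im z) ^+ 2).

Lemma norm_cabs z : `|z| = (cabs z)%:C.
Proof. exact: normc_def. Qed.

Lemma cabs_ge0 z : 0 <= cabs z.
Proof. exact: sqrtr_ge0. Qed.

Lemma cabsM z w : cabs (z * w) = cabs z * cabs w.
Proof. by apply: complexI; rewrite real_complexM -!norm_cabs normrM. Qed.

Lemma cabsV z : cabs z^-1 = (cabs z)^-1.
Proof. by apply: complexI; rewrite real_complexV -!norm_cabs normfV. Qed.

Lemma cabs_div z w : cabs (z / w) = cabs z / cabs w.
Proof. by rewrite cabsM cabsV. Qed.

Lemma cabsD z w : cabs (z + w) <= cabs z + cabs w.
Proof. by rewrite -lecR real_complexD -!norm_cabs ler_normD. Qed.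

Lemma cabsN z : cabs (- z) = cabs z.
Proof. by apply: complexI; rewrite -!norm_cabs normrN. Qed.

Lemma cabsB z w : cabs (z - w) = cabs (w - z).
Proof. by rewrite -cabsN opprB. Qed.

Lemma cabs_le_triB z w : cabs z - cabs w <= cabs (z - w).
Proof. by rewrite lerBlDr -{1}(subrK w z) cabsD. Qed.

Lemma cabs0 : cabs 0 = 0.
Proof. by apply: complexI; rewrite -norm_cabs normr0. Qed.

Lemma cabs1 : cabs 1 = 1.
Proof. by apply: complexI; rewrite -norm_cabs normr1. Qed.

Lemma cabs_real (x : R) : cabs x%:C = `|x|.
Proof. by rewrite /cabs /= expr0n /= addr0 sqrtr_sqr. Qed.

Lemma cabs_eq0 z : (cabs z == 0) = (z == 0).
Proof. by rewrite -(inj_eq (@complexI R)) -norm_cabs normr_eq0. Qed.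

Lemma cabs_gt0 z : (0 < cabs z) = (z != 0).
Proof. by rewrite lt_def cabs_ge0 andbT cabs_eq0. Qed.

Lemma cabsX z n : cabs (z ^+ n) = cabs z ^+ n.
Proof. by elim: n => [|n IH]; rewrite ?expr0 ?cabs1// !exprS cabsM IH. Qed.

Lemma cabs_sqr z : cabs z ^+ 2 = (complex.Re z) ^+ 2 + (complex.Im z) ^+ 2.
Proof. by rewrite sqr_sqrtr// addr_ge0 ?sqr_ge0. Qed.

Lemma Re_le_cabs z : `|complex.Re z| <= cabs z.
Proof. by rewrite -sqrtr_sqr ler_wsqrtr// lerDl sqr_ge0. Qed.

Lemma Im_le_cabs z : `|complex.Im z| <= cabs z.
Proof. by rewrite -sqrtr_sqr ler_wsqrtr// lerDr sqr_ge0. Qed.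

Lemma cabs_le_ReIm z : cabs z <= `|complex.Re z| + `|complex.Im z|.
Proof.
rewrite -(@ger0_norm _ (_ + _)) ?addr_ge0// -sqrtr_sqr ler_wsqrtr//.
rewrite sqrrD !real_normK ?num_real// -addrA [_ *+ 2 + _]addrC addrA lerDl.
by rewrite mulrn_wge0// mulr_ge0.
Qed.

Lemma complexRIE z : z = (complex.Re z)%:C + (complex.Im z)%:C * 'i.
Proof. by rewrite mulrC -complexE. Qed.

Lemma cReM z w : complex.Re (z * w) =
  complex.Re z * complex.Re w - complex.Im z * complex.Im w.
Proof. by case: z; case: w. Qed.

Lemma cImM z w : complex.Im (z * w) =
  complex.Re z * complex.Im w + complex.Im z * complex.Re w.
Proof. by case: z; case: w. Qed.

Lemma cReD z w : complex.Re (z + w) = complex.Re z + complex.Re w.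
Proof. by case: z; case: w. Qed.

Lemma cImD z w : complex.Im (z + w) = complex.Im z + complex.Im w.
Proof. by case: z; case: w. Qed.

Lemma cReN z : complex.Re (- z) = - complex.Re z.
Proof. by case: z. Qed.

Lemma cImN z : complex.Im (- z) = - complex.Im z.
Proof. by case: z. Qed.

Lemma near_complexP z (P : set R[i]) :
  (\forall w \near z, P w) <->
  exists2 r : R, 0 < r & forall w, cabs (w - z) < r -> P w.
Proof.
split=> [/nbhs_normP[/= e e0 zP]|[r r0 zP]].
  have ee : e = (complex.Re e)%:C.
    by rewrite RRe_real// realE (ltW e0).
  exists (complex.Re e); first by rewrite -ltcR -ee.
  by move=> w wz; apply: zP => /=; rewrite distrC norm_cabs ee ltcR.
apply/nbhs_normP; exists r%:C => /=; first by rewrite ltcR.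
by move=> w /=; rewrite distrC norm_cabs ltcR => /zP.
Qed.

Lemma cvg_complexP (T : Type) (A : set_system T) (FA : Filter A) (f : T -> R[i]) z :
  f @ A --> z <-> forall eps : R, 0 < eps -> \forall t \near A, cabs (f t - z) < eps.
Proof.
split=> [fz eps e0|H].
  by apply: (fz [set w | cabs (w - z) < eps]); apply/near_complexP; exists eps.
move=> P /near_complexP[r r0 zP]; rewrite /nbhs /=.
by apply: filterS (H r r0) => t; exact: zP.
Qed.

Lemma is_derive_complexP z F d :
  is_derive z 1 F d <->
  forall eps : R, 0 < eps -> exists2 r : R, 0 < r &
    forall h, cabs h < r -> cabs (F (z + h) - F z - h * d) <= eps * cabs h.
Proof.
pose Q := fun h : R[i] => h^-1 *: ((F \o shift z) (h *: (1 : R[i])) - F z).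
have QE h : h != 0 -> Q h - d = h^-1 * (F (z + h) - F z - h * d).
  by move=> h0; rewrite /Q /= [_ *: 1]mulr1 [h + z]addrC mulrBr mulrA mulVf// mul1r.
split=> [[dF dFE] eps e0|H].
  have /cvg_complexP : Q @ 0^' --> d by rewrite -dFE; exact: dF.
  move=> /(_ eps e0) /near_complexP[r r0 Hr]; exists r => // h hr.
  have [->|h0] := eqVneq h 0.
    by rewrite addr0 subrr mul0r subr0 cabs0 mulr0.
  have := Hr h; rewrite subr0 => /(_ hr h0) /ltW.
  by rewrite QE// cabsM cabsV mulrC ler_pdivrMr// cabs_gt0.
suff Qd : Q @ 0^' --> d.
  by apply: DeriveDef; [apply/cvg_ex; exists d | exact: cvg_lim Qd].
apply/cvg_complexP => eps e0.
have e2 : 0 < eps / 2 by rewrite divr_gt0.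
have [r r0 Hr] := H _ e2.
apply/near_complexP; exists r => // h; rewrite subr0 => hr h0.
rewrite QE// cabsM cabsV mulrC ltr_pdivrMr ?cabs_gt0//.
apply: le_lt_trans (Hr h hr) _.
by rewrite ltr_pM2r ?cabs_gt0// ltr_pdivrMr// ltr_pMr// ltr1n.
Qed.

End ComplexTopology.

(** * Complex derivatives along real lines *)

Section Lines.
Variable R : realType.
Implicit Types (z w e : R[i]) (F G : R[i] -> R[i]).

Lemma is_derive_real_eps (f : R -> R) (t d : R) :
  (forall eps : R, 0 < eps -> exists2 r : R, 0 < r &
    forall h : R, `|h| < r -> `|f (t + h) - f t - h * d| <= eps * `|h|) ->
  is_derive t 1 f d.
Proof.
move=> H; pose Q := fun h : R => h^-1 *: ((f \o shift t) (h *: (1 : R)) - f t).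
suff Qd : Q @ 0^' --> d.
  by apply: DeriveDef; [apply/cvg_ex; exists d | exact: cvg_lim Qd].
apply/cvgrPdist_lt => eps e0.
have e2 : 0 < eps / 2 by rewrite divr_gt0.
have [r r0 Hr] := H _ e2.
apply/nbhs_normP; exists r => //= h /=; rewrite sub0r normrN => hr h0.
have -> : d - Q h = - (h^-1 * (f (t + h) - f t - h * d)).
  rewrite /Q /= [_ *: 1]mulr1 [h + t]addrC /GRing.scale /=.
  by field.
rewrite normrN normrM normfV mulrC ltr_pdivrMr ?normr_gt0//.
apply: le_lt_trans (Hr h hr) _.
by rewrite ltr_pM2r ?normr_gt0// ltr_pdivrMr// ltr_pMr// ltr1n.
Qed.

(** Real partial derivatives are read off the complex derivative: e = 1 gives the
    horizontal direction, e = 'i the vertical one. *)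
Lemma is_derive_Re_line F z e (t : R) d : is_derive (z + t%:C * e) 1 F d ->
  is_derive t 1 (fun s : R => complex.Re (F (z + s%:C * e))) (complex.Re (d * e)).
Proof.
move=> /is_derive_complexP dF; apply: is_derive_real_eps => eps e0.
have c0 : 0 < cabs e + 1 by rewrite ltr_wpDl ?cabs_ge0.
have [r r0 Hr] := dF (eps / (cabs e + 1)) (divr_gt0 e0 c0).
exists (r / (cabs e + 1)); first by rewrite divr_gt0.
move=> h hr.
have ch : cabs (h%:C * e) <= `|h| * (cabs e + 1).
  by rewrite cabsM cabs_real ler_wpM2l// lerDl.
have := Hr (h%:C * e) (le_lt_trans ch _); rewrite -ltr_pdivlMr// => /(_ hr) H.
have -> : complex.Re (F (z + (t + h)%:C * e)) - complex.Re (F (z + t%:C * e))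
   - h * complex.Re (d * e) = complex.Re (F (z + t%:C * e + h%:C * e)
     - F (z + t%:C * e) - h%:C * e * d).
  rewrite real_complexD mulrDl addrA !cReD !cReN [X in _ = _ - _ - X]/= -mulrA [e * d]mulrC.
  by congr (_ - _); rewrite [in RHS]cReM /= mul0r subr0.
apply: le_trans (Re_le_cabs _) (le_trans H _).
apply: le_trans (ler_wpM2l _ ch) _; first by rewrite ltW// divr_gt0.
by rewrite mulrCA divfK ?gt_eqF// mulrC.
Qed.

Lemma ReNiM z : complex.Re (- 'i * z) = complex.Im z.
Proof. by case: z => a b /=; ring. Qed.

Lemma is_derive_Im_line F z e (t : R) d : is_derive (z + t%:C * e) 1 F d ->
  is_derive t 1 (fun s : R => complex.Im (F (z + s%:C * e))) (complex.Im (d * e)).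
Proof.
move=> dF.
have dF' : is_derive (z + t%:C * e) 1 (fun w => - 'i * F w) (- 'i * d).
  by apply: is_derive_eq (is_deriveZ _ dF) _.
have := is_derive_Re_line dF'; rewrite -mulrA ReNiM.
by under eq_fun do rewrite ReNiM.
Qed.

(** If f'' were positive at an interior maximum, f' would be positive just to the
    right of it and the mean value theorem would push f above its maximum. *)
Lemma second_derivative_le0 (f f1 : R -> R) (r c : R) : 0 < r ->
  (forall t : R, `|t| < r -> is_derive t 1 f (f1 t)) ->
  is_derive (0 : R) 1 f1 c -> (forall t, `|t| < r -> f t <= f 0) -> c <= 0.
Proof.
move=> r0 df df1 fmax.
have f10 : f1 0 = 0.
  have d0 : is_derive (0 : R) 1 f 0.
    apply: (@derive1_at_max _ f (- r) r) => //.
    - by rewrite (@le_trans _ _ 0)// ?oppr_le0 ltW.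
    - by move=> t; rewrite in_itv /= -ltr_norml => /df[].
    - by rewrite in_itv /= oppr_lt0 r0.
    - by move=> t; rewrite in_itv /= -ltr_norml => /fmax.
  have := df 0; rewrite normr0 => /(_ r0) d1.
  by rewrite -(@derive_val _ _ _ _ _ _ _ d1) (@derive_val _ _ _ _ _ _ _ d0).
rewrite leNgt; apply/negP => c0.
have [df1' df1E] := df1.
have : (fun h : R => h^-1 *: ((f1 \o shift 0) (h *: (1:R)) - f1 0)) @ 0^' --> c.
  by rewrite -df1E; exact: df1'.
move=> /cvgrPdist_lt /(_ c c0) /nbhs_normP[/= s s0 Hs].
have m0 : 0 < Num.min r s by rewrite lt_min r0 s0.
pose t := Num.min r s / 2.
have t0 : 0 < t by rewrite divr_gt0.
have tm : t < Num.min r s by rewrite ltr_pdivrMr// ltr_pMr// ltr1n.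
have [||x] := @MVT R f f1 0 t t0.
- move=> x; rewrite in_itv /= => /andP[x0 xt]; apply: df.
  by rewrite gtr0_norm//; move: (lt_trans xt tm); rewrite lt_min => /andP[].
- apply: derivable_within_continuous => x; rewrite in_itv /= => /andP[x0 xt].
  have /df[] // : `|x| < r.
  by rewrite ger0_norm//; move: (le_lt_trans xt tm); rewrite lt_min => /andP[].
rewrite in_itv /= subr0 => /andP[x0 xt] E.
have fx : 0 < f1 x.
  have : 0 < x^-1 * f1 x.
    have := Hs x; rewrite /= sub0r normrN gtr0_norm// => H.
    have xs : x < s by move: (lt_trans xt tm); rewrite lt_min => /andP[].
    move: (H xs (lt0r_neq0 x0)); rewrite f10 subr0 addr0 [_ *: 1]mulr1 /GRing.scale /=.
    by rewrite ltr_norml => /andP[_]; rewrite ltrBlDr ltrDl.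
  by rewrite pmulr_rgt0// invr_gt0.
have := fmax t; rewrite gtr0_norm// => /(_ _).
have -> : t < r by move: tm; rewrite lt_min => /andP[].
by move=> /(_ isT); rewrite leNgt -subr_gt0 E mulr_gt0.
Qed.

End Lines.

(** * Subharmonicity and compactness *)

Section MaximumPrinciple.
Variable R : realType.
Implicit Types (z w e : R[i]) (F G : R[i] -> R[i]).

(** Two derivatives are all that the maximum principle uses; asking for both avoids
    proving that one complex derivative implies the next. *)
Definition holo2 (S : set R[i]) F := exists F1 F2 : R[i] -> R[i],
  forall z, S z -> is_derive z 1 F (F1 z) /\ is_derive z 1 F1 (F2 z).

Lemma is_derive_cMr F z e d : is_derive z 1 F d ->
  is_derive z 1 (fun w => F w * e) (d * e).
Proof.
move=> dF; under eq_fun do rewrite mulrC.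
by apply: is_derive_eq (is_deriveZ _ dF) _; rewrite mulrC.
Qed.

(** The second-derivative test on A^2 + B^2 + g plus a quadratic; along a line, A
    and B will be the real and imaginary parts of F, and g the real part of G. *)
Lemma second_order_le0 (A B g A1 B1 g1 : R -> R) (x k eta r a2 b2 g2 : R) : 0 < r ->
  (forall s : R, `|s| < r -> is_derive s 1 A (A1 s)) ->
  (forall s : R, `|s| < r -> is_derive s 1 B (B1 s)) ->
  (forall s : R, `|s| < r -> is_derive s 1 g (g1 s)) ->
  is_derive (0 : R) 1 A1 a2 -> is_derive (0 : R) 1 B1 b2 ->
  is_derive (0 : R) 1 g1 g2 ->
  (forall s : R, `|s| < r ->
     A s ^+ 2 + B s ^+ 2 + g s + eta * (x + s * k) ^+ 2 <=
     A 0 ^+ 2 + B 0 ^+ 2 + g 0 + eta * (x + 0 * k) ^+ 2) ->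
  2 * (A1 0 ^+ 2 + B1 0 ^+ 2 + A 0 * a2 + B 0 * b2) + g2 + 2 * eta * k ^+ 2 <= 0.
Proof.
move=> r0 dA dB dg dA1 dB1 dg1 fmax.
pose X : R -> R := cst x + id * cst k.
have dX (s : R) : is_derive s 1 X k.
  by apply: is_derive_eq; rewrite /GRing.scale /=; ring.
pose f : R -> R := A * A + B * B + g + cst eta * (X * X).
pose f1 : R -> R := cst 2 * (A * A1 + B * B1) + g1 + cst (2 * eta * k) * X.
have df (s : R) : `|s| < r -> is_derive s 1 f (f1 s).
  move=> sr; have dAs := dA s sr; have dBs := dB s sr; have dgs := dg s sr.
  have dXs := dX s.
  have h1 := is_deriveM dAs dAs; have h2 := is_deriveM dBs dBs.
  have h3 := is_deriveM (is_derive_cst eta s (1 : R)) (is_deriveM dXs dXs).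
  apply: is_derive_eq (is_deriveD (is_deriveD (is_deriveD h1 h2) dgs) h3) _.
  by rewrite /f1 !fctE /GRing.scale /=; ring.
have n0 : `|0 : R| < r by rewrite normr0.
have df1 : is_derive (0 : R) 1 f1
    (2 * (A1 0 ^+ 2 + B1 0 ^+ 2 + A 0 * a2 + B 0 * b2) + g2 + 2 * eta * k ^+ 2).
  have h1 := is_deriveM (dA 0 n0) dA1; have h2 := is_deriveM (dB 0 n0) dB1.
  have h3 := is_deriveM (is_derive_cst (2 : R) (0 : R) (1 : R)) (is_deriveD h1 h2).
  have h4 := is_deriveM (is_derive_cst (2 * eta * k) (0 : R) (1 : R)) (dX 0).
  apply: is_derive_eq (is_deriveD (is_deriveD h3 dg1) h4) _.
  by rewrite !fctE /GRing.scale /=; ring.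
have fm (s : R) : `|s| < r -> f s <= f 0.
  by move=> /fmax; rewrite /f /X !fctE -!expr2.
exact: (second_derivative_le0 r0 df df1 fm).
Qed.

Lemma second_order_dir_le0 F G (F1 F2 G1 G2 : R[i] -> R[i]) z e (r eta : R) :
  0 < r -> cabs e = 1 ->
  (forall w, cabs (w - z) < r -> is_derive w 1 F (F1 w) /\ is_derive w 1 F1 (F2 w)) ->
  (forall w, cabs (w - z) < r -> is_derive w 1 G (G1 w) /\ is_derive w 1 G1 (G2 w)) ->
  (forall w, cabs (w - z) < r ->
     cabs (F w) ^+ 2 + complex.Re (G w) + eta * complex.Re w ^+ 2 <=
     cabs (F z) ^+ 2 + complex.Re (G z) + eta * complex.Re z ^+ 2) ->
  2 * (cabs (F1 z * e) ^+ 2 + complex.Re (F z) * complex.Re (F2 z * e * e)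
       + complex.Im (F z) * complex.Im (F2 z * e * e))
  + complex.Re (G2 z * e * e) + 2 * eta * complex.Re e ^+ 2 <= 0.
Proof.
move=> r0 e1 dF dG zmax.
pose p (s : R) := z + s%:C * e.
have pz : p 0 = z by rewrite /p mul0r addr0.
have pr s : `|s| < r -> cabs (p s - z) < r.
  by rewrite /p addrC addKr cabsM cabs_real e1 mulr1.
have dA (s : R) : `|s| < r ->
    is_derive s 1 (fun s => complex.Re (F (p s))) (complex.Re (F1 (p s) * e)).
  by move=> /pr /dF[d1 _]; exact: is_derive_Re_line.
have dB (s : R) : `|s| < r ->
    is_derive s 1 (fun s => complex.Im (F (p s))) (complex.Im (F1 (p s) * e)).
  by move=> /pr /dF[d1 _]; exact: is_derive_Im_line.
have dg (s : R) : `|s| < r ->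
    is_derive s 1 (fun s => complex.Re (G (p s))) (complex.Re (G1 (p s) * e)).
  by move=> /pr /dG[d1 _]; exact: is_derive_Re_line.
have n0 : `|0 : R| < r by rewrite normr0.
have dA1 : is_derive (0 : R) 1 (fun s => complex.Re (F1 (p s) * e))
    (complex.Re (F2 z * e * e)).
  have [_ d2] := dF _ (pr _ n0); rewrite pz in d2.
  apply: (@is_derive_Re_line _ (fun w => F1 w * e)); rewrite -/(p 0) pz.
  exact: is_derive_cMr.
have dB1 : is_derive (0 : R) 1 (fun s => complex.Im (F1 (p s) * e))
    (complex.Im (F2 z * e * e)).
  have [_ d2] := dF _ (pr _ n0); rewrite pz in d2.
  apply: (@is_derive_Im_line _ (fun w => F1 w * e)); rewrite -/(p 0) pz.
  exact: is_derive_cMr.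
have dg1 : is_derive (0 : R) 1 (fun s => complex.Re (G1 (p s) * e))
    (complex.Re (G2 z * e * e)).
  have [_ d2] := dG _ (pr _ n0); rewrite pz in d2.
  apply: (@is_derive_Re_line _ (fun w => G1 w * e)); rewrite -/(p 0) pz.
  exact: is_derive_cMr.
have xE (s : R) : complex.Re z + s * complex.Re e = complex.Re (p s).
  by rewrite /p cReD cReM /= mul0r subr0.
have := @second_order_le0 _ _ _ _ _ _ (complex.Re z) (complex.Re e) eta r _ _ _
  r0 dA dB dg dA1 dB1 dg1.
rewrite !pz cabs_sqr; apply => s sr.
by rewrite !xE pz -!cabs_sqr; exact: zmax (pr s sr).
Qed.

(** Summing the second-derivative tests in the directions 1 and 'i, the terms in F''
    and G'' cancel because 'i ^ 2 = -1, and what is left, 4 |F'|^2 + 2 eta <= 0, is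
    absurd. *)
Lemma no_local_max F G (F1 F2 G1 G2 : R[i] -> R[i]) z (r eta : R) :
  0 < r -> 0 < eta ->
  (forall w, cabs (w - z) < r -> is_derive w 1 F (F1 w) /\ is_derive w 1 F1 (F2 w)) ->
  (forall w, cabs (w - z) < r -> is_derive w 1 G (G1 w) /\ is_derive w 1 G1 (G2 w)) ->
  (forall w, cabs (w - z) < r ->
     cabs (F w) ^+ 2 + complex.Re (G w) + eta * complex.Re w ^+ 2 <=
     cabs (F z) ^+ 2 + complex.Re (G z) + eta * complex.Re z ^+ 2) -> False.
Proof.
move=> r0 eta0 dF dG zmax.
have ci : cabs 'i%C = 1 :> R by rewrite /cabs /= expr0n add0r expr1n sqrtr1.
have := second_order_dir_le0 r0 (cabs1 R) dF dG zmax.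
have := second_order_dir_le0 r0 ci dF dG zmax.
rewrite !mulr1 cabsM ci mulr1 -!mulrA.
have -> : 'i * 'i = -1 :> R[i] by rewrite -expr2 sqr_i.
rewrite !mulrN1 !(cReN, cImN) /= expr0n /= expr1n.
have := sqr_ge0 (cabs (F1 z)).
lra.
Qed.

Lemma Re_continuous : continuous (@complex.Re R : R[i] -> R).
Proof.
move=> z; apply/(@cvgrPdist_lt _ _ _ (nbhs z)) => eps e0; apply/near_complexP; exists eps => // w wz.
by rewrite -cReN -cReD; apply: le_lt_trans (Re_le_cabs _) _; rewrite -cabsN opprB.
Qed.

Lemma Im_continuous : continuous (@complex.Im R : R[i] -> R).
Proof.
move=> z; apply/(@cvgrPdist_lt _ _ _ (nbhs z)) => eps e0; apply/near_complexP; exists eps => // w wz.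
by rewrite -cImN -cImD; apply: le_lt_trans (Im_le_cabs _) _; rewrite -cabsN opprB.
Qed.

Lemma cabs_continuous : continuous (@cabs R : R[i] -> R).
Proof.
move=> z; apply/(@cvgrPdist_lt _ _ _ (nbhs z)) => eps e0; apply/near_complexP; exists eps => // w wz.
rewrite ltr_norml ltrNl opprB !(le_lt_trans (cabs_le_triB _ _))// cabsB//.
Qed.

Lemma is_derive_continuous F z d : is_derive z 1 F d -> {for z, continuous F}.
Proof. by move=> [dF _]; apply/differentiable_continuous/derivable1_diffP. Qed.

Lemma compact_rectangle (a b c d : R) :
  compact [set w : R[i] | complex.Re w \in `[a, b] /\ complex.Im w \in `[c, d]].
Proof.
have -> : [set w : R[i] | complex.Re w \in `[a, b] /\ complex.Im w \in `[c, d]] =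
    (fun p : R * R => p.1 +i* p.2) @` (`[a, b]%classic `*` `[c, d]%classic).
  apply/seteqP; split=> [w [wr wi]|w [[x y] [/= xi yi] <-]]; last by [].
  by exists (complex.Re w, complex.Im w) => //=; case: w {wr wi}.
apply: continuous_compact; last by apply: compact_setX; exact: segment_compact.
apply: continuous_subspaceT => -[x y].
apply/cvg_complexP => eps e0; near=> p => /=.
have px : `|x - p.1| < eps / 2.
  near: p; have : {for (x, y), continuous (@fst R R)} by exact: cvg_fst.
  by move=> /cvgrPdist_lt; apply; rewrite divr_gt0.
have py : `|y - p.2| < eps / 2.
  near: p; have : {for (x, y), continuous (@snd R R)} by exact: cvg_snd.
  by move=> /cvgrPdist_lt; apply; rewrite divr_gt0.
apply: le_lt_trans (cabs_le_ReIm _) _ => /=.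
by rewrite (splitr eps) ltrD// distrC.
Unshelve. all: by end_near. Qed.

End MaximumPrinciple.

(** * The maximum principle on a strip *)

Section StripMaximum.
Variable R : realType.
Implicit Types (z w e : R[i]) (F G : R[i] -> R[i]).

Definition strip (a b : R) : set R[i] := [set w | a < complex.Im w < b].

Lemma strip_near (a b : R) w : strip a b w -> \forall w' \near w, strip a b w'.
Proof.
move=> /andP[aw wb]; apply/near_complexP.
exists (Num.min (complex.Im w - a) (b - complex.Im w)).
  by rewrite lt_min !subr_gt0 aw wb.
move=> v; rewrite lt_min => /andP[h1 h2].
have := Im_le_cabs (v - w); rewrite cImD cImN => h3.
have := le_lt_trans h3 h1; have := le_lt_trans h3 h2.
by rewrite !ltr_norml /strip /= => /andP[? ?] /andP[? ?]; apply/andP; split; lra.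
Qed.

(** The strip is unbounded and u need not extend to its edges, so boundary values
    enter as upper limits.  They make each superlevel set of u at a positive level
    compact, and a maximum of u + eta (Re w)^2 over it is a local maximum in the
    strip as soon as eta is small enough for u to exceed the level there. *)
Theorem strip_maximum (a b : R) F G (u : R[i] -> R) :
  (forall w, u w = cabs (F w) ^+ 2 + complex.Re (G w)) ->
  holo2 (strip a b) F -> holo2 (strip a b) G ->
  (forall eps w0, 0 < eps -> complex.Im w0 = a \/ complex.Im w0 = b ->
     \forall w \near w0, strip a b w -> u w < eps) ->
  (forall eps, 0 < eps -> exists X : R, forall w, strip a b w ->
     X <= `|complex.Re w| -> u w < eps) ->
  forall w, strip a b w -> u w <= 0.
Proof.
move=> uE [F1 [F2 dF]] [G1 [G2 dG]] ubd uend w1 Sw1.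
rewrite leNgt; apply/negP => u1.
pose eps := u w1 / 2.
have e0 : 0 < eps by rewrite divr_gt0.
have [X endX] := uend _ e0.
have ucont w : strip a b w -> {for w, continuous u}.
  move=> Sw; have [/is_derive_continuous cF _] := dF _ Sw.
  have [/is_derive_continuous cG _] := dG _ Sw.
  rewrite (_ : u = (fun w => cabs (F w) * cabs (F w) + complex.Re (G w))); last first.
    by apply/funext => v; rewrite uE expr2.
  have c1 : {for w, continuous (fun v => cabs (F v))}.
    by apply: continuous_comp cF _; exact: cabs_continuous.
  have c2 : {for w, continuous (fun v => complex.Re (G v))}.
    by apply: continuous_comp cG _; exact: Re_continuous.
  exact: cvgD (cvgM c1 c1) c2.
pose K := [set w | strip a b w /\ eps <= u w].
have KX w : K w -> `|complex.Re w| < X.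
  move=> [Sw uw]; rewrite ltNge; apply/negP => /(endX _ Sw).
  by rewrite ltNge uw.
have Kw1 : K w1 by split=> //; rewrite ler_pdivrMr// ler_pMr// ler1n.
have clK : closed K.
  move=> w clw; apply: contrapT => nKw.
  suff nK : \forall v \near w, ~ K v by have [v [Kv]] := clw _ nK; exact.
  have [Sw|nSw] := pselect (strip a b w).
    have uw : u w < eps by rewrite ltNge; apply/negP => h; apply: nKw.
    have := ucont _ Sw => /cvgrPdist_lt /(_ (eps - u w)); rewrite subr_gt0.
    move=> /(_ uw); apply: filterS => v uv [_]; apply/negP; rewrite -ltNge.
    by move: uv; rewrite ltr_norml => /andP[]; lra.
  have [h|h] := pselect (complex.Im w = a \/ complex.Im w = b).
    apply: filterS (ubd _ _ e0 h) => v uv [/uv]; rewrite ltNge; exact/negP.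
  have {}h : complex.Im w < a \/ b < complex.Im w.
    have [?|?|?] := ltgtP (complex.Im w) a; [by left| |by case: h; left].
    have [?|?|?] := ltgtP (complex.Im w) b; [|by right|by case: h; right].
    by case: nSw; apply/andP.
  have ci := @Im_continuous R w.
  case: h => h.
    have := ci => /cvgrPdist_lt /(_ (a - complex.Im w)); rewrite subr_gt0.
    move=> /(_ h); apply: filterS => v iv [/andP[av _] _].
    by move: iv; rewrite ltr_norml => /andP[]; lra.
  have := ci => /cvgrPdist_lt /(_ (complex.Im w - b)); rewrite subr_gt0.
  move=> /(_ h); apply: filterS => v iv [/andP[_ vb] _].
  by move: iv; rewrite ltr_norml => /andP[]; lra.
have cK : compact K.
  apply: subclosed_compact clK (@compact_rectangle R (- X) X a b) _.
  move=> w Kw; have [/andP[aw wb] _] := Kw.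
  rewrite /= !in_itv /= (ltW aw) (ltW wb) -ler_norml.
  by split=> //; exact/ltW/KX.
(* The perturbation stays below eps on K, hence below the gap between the level eps
   and u w1 = 2 eps. *)
pose eta := eps / (X ^+ 2 + 1).
have X1 : 0 < X ^+ 2 + 1 by rewrite ltr_wpDl ?sqr_ge0.
have eta0 : 0 < eta by rewrite divr_gt0.
have etaX : eta * X ^+ 2 < eps.
  by rewrite /eta mulrAC ltr_pdivrMr// ltr_pM2l// ltrDl.
pose v w := u w + eta * complex.Re w ^+ 2.
have vcont : {within K, continuous v}.
  apply: continuous_in_subspaceT => w; rewrite inE => -[Sw _].
  have c1 := ucont _ Sw; have c2 := @Re_continuous R w.
  have -> : v = (fun w => u w + eta * (complex.Re w * complex.Re w)).
    by apply/funext => w'; rewrite /v expr2.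
  exact: cvgD c1 (cvgM (cvg_cst eta) (cvgM c2 c2)).
have [w2 + vmax] := compact_EVT_max (ex_intro _ _ Kw1) cK vcont.
rewrite inE => Kw2; have [Sw2 uw2] := Kw2.
have uw2' : eps < u w2.
  have := vmax w1; rewrite inE => /(_ Kw1); rewrite /v => h.
  have h1 : eta * complex.Re w2 ^+ 2 <= eta * X ^+ 2.
    rewrite ler_pM2l// -ler_sqrt ?sqr_ge0// !sqrtr_sqr.
    by apply: le_trans (ltW (KX _ Kw2)) (ler_norm _).
  have h2 : 0 <= eta * complex.Re w1 ^+ 2 by rewrite mulr_ge0 ?sqr_ge0// ltW.
  have h3 : u w1 = eps + eps by rewrite /eps -splitr.
  lra.
have : \forall w \near w2, strip a b w /\ eps < u w.
  apply: filterI; first exact: strip_near.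
  have := ucont _ Sw2 => /cvgrPdist_lt /(_ (u w2 - eps)); rewrite subr_gt0.
  move=> /(_ uw2'); apply: filterS => w.
  by rewrite ltr_norml => /andP[]; lra.
move=> /near_complexP[r r0 Hr].
apply: (@no_local_max R F G F1 F2 G1 G2 w2 r eta) => // [w /Hr[/dF]|w /Hr[/dG]|w /Hr[Sw uw]] //.
rewrite -!uE; apply: vmax; rewrite inE; split=> //; exact: ltW.
Qed.

End StripMaximum.

(** * The complex exponential *)

Lemma is_derive_chain (K : numFieldType) (F G : K -> K) (z d e : K) :
  is_derive z 1 F d -> is_derive (F z) 1 G e ->
  is_derive z 1 (fun w => G (F w)) (e * d).
Proof.
move=> [dF <-] [dG <-].
have /derivable1_diffP DF := dF; have /derivable1_diffP DG := dG.
apply: DeriveDef; first exact/derivable1_diffP/differentiable_comp.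
rewrite -derive1E derive1E'; last exact/differentiable_comp.
rewrite (@diff_comp _ _ _ _ F G z)// /=.
rewrite -!derive1E !derive1E' //= -[X in 'd _ _ X = _]mulr1.
by rewrite [LHS]linearZ mulrC.
Qed.

Section ComplexExp.
Variable R : realType.
Implicit Types (z w : R[i]) (F G : R[i] -> R[i]).

Definition cexp z : R[i] :=
  (expR (complex.Re z))%:C * (cos (complex.Im z) +i* sin (complex.Im z)).

Lemma cexpD z w : cexp (z + w) = cexp z * cexp w.
Proof.
rewrite /cexp cReD cImD expRD cosD sinD real_complexM mulrACA; congr (_ * _).
by apply/eqP; rewrite eq_complex /= eqxx /= addrC eqxx.
Qed.

Lemma cexp0 : cexp 0 = 1.
Proof. by rewrite /cexp /= expR0 cos0 sin0 mul1r. Qed.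

Lemma cabs_cexp z : cabs (cexp z) = expR (complex.Re z).
Proof.
rewrite cabsM cabs_real ger0_norm ?expR_ge0// /cabs /= cos2Dsin2 sqrtr1.
by rewrite mulr1.
Qed.

Lemma cexp_real (x : R) : cexp x%:C = (expR x)%:C.
Proof. by rewrite /cexp /= cos0 sin0 mulr1. Qed.

Lemma cexp_Ox (t : R) : cexp (0 +i* t) = cos t +i* sin t.
Proof. by rewrite /cexp /= expR0 mul1r. Qed.

Lemma conj_cexp z : (cexp z)^* = cexp (z^*).
Proof. by case: z => x y; rewrite /cexp /= cosN sinN; simpc. Qed.

Lemma is_derive_real_near (f : R -> R) (t d : R) : is_derive t 1 f d ->
  forall eps : R, 0 < eps ->
  \forall h \near 0, `|f (t + h) - f t - h * d| <= eps * `|h|.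
Proof.
move=> [df dfE] eps e0.
pose Q := fun h : R => h^-1 *: ((f \o shift t) (h *: (1 : R)) - f t).
have /cvgrPdist_lt /(_ _ e0)/nbhs_normP[r /= r0 Hr] : Q @ 0^' --> d.
  by rewrite -dfE; exact: df.
apply/nbhs_normP; exists r => // h /= hr.
have [->|h0] := eqVneq h 0; first by rewrite addr0 subrr mul0r subr0 normr0 mulr0.
have := Hr h hr h0; rewrite distrC => /ltW.
have -> : Q h - d = h^-1 * (f (t + h) - f t - h * d).
  by rewrite /Q /= [_ *: 1]mulr1 [h + t]addrC /GRing.scale /=; field.
by rewrite normrM normfV mulrC ler_pdivrMr ?normr_gt0.
Qed.

(** By the addition formula only the derivative at 0 matters; there the remainder
    splits as e^x - 1 - x, e^x (cos y - 1 + i (sin y - y)) and i y (e^x - 1), each of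
    which is controlled by a real derivative at 0. *)
Lemma is_derive_cexp z : is_derive z 1 cexp (cexp z).
Proof.
apply/is_derive_complexP => eps e0.
pose m := eps / cabs (cexp z) / 4.
have cz : 0 < cabs (cexp z) by rewrite cabs_cexp expR_gt0.
have m0 : 0 < m by rewrite !divr_gt0.
have m2 : 0 < m / 2 by rewrite divr_gt0.
have h1 := is_derive_real_near (is_derive_expR (0 : R)) m0.
have h2 := is_derive_real_near (is_derive_cos (0 : R)) m2.
have h3 := is_derive_real_near (is_derive_sin (0 : R)) m2.
have h4 : \forall x \near 0, `|expR (0 : R) - expR x| < Num.min m 1.
  have := @continuous_expR R 0 => /cvgrPdist_lt; apply.
  by rewrite lt_min m0 ltr01.
have : \forall x \near (0 : R), (`|expR (0 + x) - expR 0 - x * expR 0| <= m * `|x| /\ `|cos (0 + x) - cos 0 - x * - sin 0| <= m / 2 * `|x|) /\ (`|sin (0 + x) - sin 0 - x * cos 0| <= m / 2 * `|x| /\ `|expR 0 - expR x| < Num.min m 1).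
  by apply: filterI; apply: filterI.
move=> /nbhs_normP[/= r r0 Hr].
exists r => // h hr.
have -> : cexp (z + h) - cexp z - h * cexp z = cexp z * (cexp h - 1 - h).
  by rewrite cexpD; ring.
rewrite cabsM mulrC -ler_pdivlMr// mulrAC.
have hx := le_lt_trans (Re_le_cabs h) hr; have hy := le_lt_trans (Im_le_cabs h) hr.
set x := complex.Re h in hx *; set y := complex.Im h in hy *.
have [[H1 _] [_ H4]] := Hr x ltac:(by rewrite /= sub0r normrN).
have [[_ H2] [H3 _]] := Hr y ltac:(by rewrite /= sub0r normrN).
move: H1 H2 H3 H4; rewrite !add0r expR0 cos0 sin0 oppr0 mulr0 mulr1 !(subr0, addr0).
rewrite mulr1 => H1 H2 H3; rewrite lt_min => /andP[/ltW H4 H5].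
have -> : cexp h - 1 - h = (expR x - 1 - x)%:C +
    ((expR x)%:C * ((cos y - 1)%:C + (sin y - y)%:C * 'i) + ((expR x - 1) * y)%:C * 'i).
  by apply/eqP; rewrite eq_complex /cexp -/x -/y /=; apply/andP; split; apply/eqP;
    rewrite ?cReD ?cReN ?cImD ?cImN /= -?/x -?/y; ring.
have ci : cabs 'i%C = 1 :> R by rewrite /cabs /= expr0n add0r expr1n sqrtr1.
apply: le_trans (cabsD _ _) _; rewrite cabs_real.
have ex2 : expR x <= 2.
  by move: H5; rewrite ltr_norml => /andP[]; lra.
have K1 : cabs ((expR x)%:C * ((cos y - 1)%:C + (sin y - y)%:C * 'i)) <= 2 * (m * `|y|).
  rewrite cabsM cabs_real ger0_norm ?expR_ge0// ler_pM ?expR_ge0 ?cabs_ge0//.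
  apply: le_trans (cabsD _ _) _; rewrite cabsM ci mulr1 !cabs_real.
  rewrite (splitr m) mulrDl; exact: lerD.
have K2 : cabs (((expR x - 1) * y)%:C * 'i) <= m * `|y|.
  by rewrite cabsM ci mulr1 cabs_real normrM distrC ler_wpM2r.
apply: le_trans (lerD H1 (le_trans (cabsD _ _) (lerD K1 K2))) _.
have my : m * `|y| <= m * cabs h by rewrite ler_pM2l// Im_le_cabs.
have mx : m * `|x| <= m * cabs h by rewrite ler_pM2l// Re_le_cabs.
have -> : eps / cabs (cexp z) * cabs h = 4 * (m * cabs h).
  by rewrite /m; field; rewrite gt_eqF.
lra.
Qed.

Lemma is_derive_cexp_lin (k z : R[i]) :
  is_derive z 1 (fun w => cexp (k * w)) (k * cexp (k * z)).
Proof.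
rewrite mulrC; apply: (@is_derive_chain _ (fun w => k * w)); last exact: is_derive_cexp.
by apply: is_derive_eq (is_deriveZ k (is_derive_id z 1)) _; rewrite /GRing.scale /= mulr1.
Qed.

Lemma is_derive_horner (p : {poly R[i]}) z :
  is_derive z 1 (fun w => p.[w]) (p^`()).[z].
Proof.
elim/poly_ind: p => [|p c IH].
  under eq_fun do rewrite horner0.
  by rewrite deriv0 horner0; exact: is_derive_cst.
under eq_fun do rewrite hornerMXaddC.
rewrite derivD derivM derivX derivC addr0 mulr1 hornerD hornerM hornerX.
apply: is_derive_eq (is_deriveD (is_deriveM IH (is_derive_id z 1)) (is_derive_cst c z 1)) _.
by rewrite /GRing.scale /=; ring.
Qed.

End ComplexExp.

(** * Closure properties of twice differentiable functions *)

Section Holo2.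
Variable R : realType.
Implicit Types (z w : R[i]) (F G : R[i] -> R[i]) (S : set R[i]).

Lemma holo2W S S' F : S `<=` S' -> holo2 S' F -> holo2 S F.
Proof. by move=> SS' [F1 [F2 dF]]; exists F1, F2 => z /SS'; exact: dF. Qed.

Lemma holo2_cst S (c : R[i]) : holo2 S (fun=> c).
Proof.
exists (fun=> 0), (fun=> 0) => z _; split; exact: is_derive_cst.
Qed.

Lemma holo2D S F G : holo2 S F -> holo2 S G -> holo2 S (fun w => F w + G w).
Proof.
move=> [F1 [F2 dF]] [G1 [G2 dG]].
exists (fun w => F1 w + G1 w), (fun w => F2 w + G2 w) => z Sz.
have [f1 f2] := dF z Sz; have [g1 g2] := dG z Sz.
by split; [exact: is_deriveD f1 g1 | exact: is_deriveD f2 g2].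
Qed.

Lemma is_derive_mul F G z d e : is_derive z 1 F d -> is_derive z 1 G e ->
  is_derive z 1 (fun w => F w * G w) (d * G z + F z * e).
Proof.
move=> dF dG; apply: is_derive_eq (is_deriveM dF dG) _.
by rewrite /GRing.scale /= addrC mulrC.
Qed.

Lemma holo2M S F G : holo2 S F -> holo2 S G -> holo2 S (fun w => F w * G w).
Proof.
move=> [F1 [F2 dF]] [G1 [G2 dG]].
exists (fun w => F1 w * G w + F w * G1 w),
  (fun w => (F2 w * G w + F1 w * G1 w) + (F1 w * G1 w + F w * G2 w)) => z Sz.
have [f1 f2] := dF z Sz; have [g1 g2] := dG z Sz.
split; first exact: is_derive_mul.
by apply: is_deriveD; exact: is_derive_mul.
Qed.

Lemma holo2N S F : holo2 S F -> holo2 S (fun w => - F w).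
Proof.
move=> [F1 [F2 dF]]; exists (fun w => - F1 w), (fun w => - F2 w) => z Sz.
have [f1 f2] := dF z Sz.
by split; exact: is_deriveN.
Qed.

Lemma holo2B S F G : holo2 S F -> holo2 S G -> holo2 S (fun w => F w - G w).
Proof. by move=> hF hG; apply: holo2D => //; exact: holo2N. Qed.

Lemma is_derive_inv F z d : F z != 0 -> is_derive z 1 F d ->
  is_derive z 1 (fun w => (F w)^-1) (- d * ((F z)^-1 * (F z)^-1)).
Proof.
move=> Fz [dF dFE]; apply: DeriveDef; first exact: derivableV.
by rewrite deriveV// dFE /GRing.scale /= expr2 invfM mulrC mulrN mulNr.
Qed.

Lemma holo2V S F : (forall z, S z -> F z != 0) -> holo2 S F ->
  holo2 S (fun w => (F w)^-1).
Proof.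
move=> F0 [F1 [F2 dF]].
pose H w := (F w)^-1; pose H1 w := - F1 w * (H w * H w).
exists H1, (fun w => - F2 w * (H w * H w) + - F1 w * (H1 w * H w + H w * H1 w)).
move=> z Sz; have [f1 f2] := dF z Sz.
have dH : is_derive z 1 H (H1 z) by apply: is_derive_inv f1; exact: F0.
split; first exact: dH.
exact: is_derive_mul (is_deriveN f2) (is_derive_mul dH dH).
Qed.

Lemma holo2_div S F G : (forall z, S z -> G z != 0) ->
  holo2 S F -> holo2 S G -> holo2 S (fun w => F w / G w).
Proof. by move=> G0 hF hG; apply: holo2M => //; exact: holo2V. Qed.

Lemma holo2_cexp_lin S (k : R[i]) : holo2 S (fun w => cexp (k * w)).
Proof.
exists (fun w => k * cexp (k * w)), (fun w => k * (k * cexp (k * w))) => z _.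
split; first exact: is_derive_cexp_lin.
exact: (is_deriveZ k (is_derive_cexp_lin k z)).
Qed.

Lemma holo2_continuous S F z : holo2 S F -> S z -> {for z, continuous F}.
Proof. by move=> [F1 [F2 dF]] /dF[/is_derive_continuous]. Qed.

Lemma is_derive_real_axis F (x : R) d : (forall t : R, complex.Im (F t%:C) = 0) ->
  is_derive x%:C 1 F d -> complex.Im d = 0.
Proof.
move=> Fr dF.
have dF' : is_derive (x%:C + (0 : R)%:C * 1) 1 F d by rewrite mul0r addr0.
have := is_derive_Im_line dF'; rewrite mulr1.
have -> : (fun s : R => complex.Im (F (x%:C + s%:C * 1))) = cst 0.
  by apply/funext => s; rewrite mulr1 -real_complexD Fr.
by move=> [_ <-]; rewrite derive_cst.
Qed.

(** A quotient has a removable singularity at a common zero where the denominator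
    vanishes to first order. *)
Lemma cvg_quotient_at_zero F G z d e : F z = 0 -> G z = 0 -> e != 0 ->
  is_derive z 1 F d -> is_derive z 1 G e ->
  F w / G w @[w --> z^'] --> d / e.
Proof.
move=> Fz Gz e0 [dF dFE] [dG dGE].
pose f (h : R[i]) := h^-1 *: ((F \o shift z) (h *: (1 : R[i])) - F z).
pose g (h : R[i]) := h^-1 *: ((G \o shift z) (h *: (1 : R[i])) - G z).
have fd : f @ 0^' --> d by rewrite -dFE; exact: dF.
have ge : g @ 0^' --> e by rewrite -dGE; exact: dG.
have fg : (fun h => f h / g h) @ 0^' --> d / e by exact: cvgM fd (cvgV e0 ge).
have /cvg_complexP H := fg.
apply/cvg_complexP => eps e1.
have /near_complexP[r r0 Hr] := H eps e1.
apply/near_complexP; exists r => // w wr wz.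
have := Hr (w - z); rewrite subr0 => /(_ wr).
rewrite subr_eq0 => /(_ wz).
rewrite /f /g /= Fz Gz !subr0 ![_ *: 1]mulr1 !subrK /GRing.scale /= invfM invrK.
by rewrite mulrACA mulVf ?mul1r// subr_eq0.
Qed.

End Holo2.

(** * A Pick-type inequality on a strip *)

Section StripInterpolation.
Variable R : realType.
Implicit Types (z w : R[i]).

(** The exponential is injective on closed half-periods of the strip; this isolates
    the zeros of the denominator used below. *)
Lemma cexp_eq1 z : 0 <= complex.Im z <= pi -> cexp z = 1 -> z = 0.
Proof.
move=> /andP[i0 ipi] z1.
have : expR (complex.Re z) = 1 by rewrite -cabs_cexp z1 cabs1.
rewrite -expR0 => /expR_inj re0.
have : cos (complex.Im z) = cos 0.
  by have := congr1 (@complex.Re R) z1; rewrite /cexp re0 expR0 mul1r /= cos0.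
move=> /cos_inj im0; rewrite [z]complexRIE re0 im0 ?mul0r ?addr0//.
- by rewrite in_itv /= i0.
- by rewrite in_itv /= lexx pi_ge0.
Qed.

Variables (a b l X K : R) (mu : R[i] -> R[i]).
Hypotheses (a0 : 0 < a) (ab : a < b) (l0 : 0 < l).
Hypothesis mu_holo : holo2 (strip (- b) b) mu.
Hypothesis mu_real : forall x : R, complex.Im (mu x%:C) = 0.
Hypothesis mu_top : forall w, complex.Im w = a -> 0 <= complex.Im (mu w).
Hypothesis mu_bounded : forall w, strip 0 a w -> X <= `|complex.Re w| ->
  cabs (mu w) <= K.

(** U is the variable in which the strip 0 < Im w < a becomes the upper half plane
    and V is its inverse.  Y is mu minus its interpolant c0 + lam (U - V) at l and -l,
    and d vanishes, within the closed strip, exactly at these two nodes. *)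
Let kap := pi / a.
Let E := expR (kap * l).
Let U w := cexp (kap%:C * w).
Let V w := cexp ((- kap)%:C * w).
Let lam := (complex.Re (mu l%:C) - complex.Re (mu (- l)%:C)) / (2 * (E - E^-1)).
Let c0 := (complex.Re (mu l%:C) + complex.Re (mu (- l)%:C)) / 2.
Let Y w := mu w - c0%:C - lam%:C * (U w - V w).
Let d w := (E + E^-1)%:C - U w - V w.

Let kap0 : 0 < kap. Proof. by rewrite divr_gt0 ?pi_gt0. Qed.
Let kapa : kap * a = pi. Proof. by rewrite divfK// gt_eqF. Qed.
Let E1 : 1 < E. Proof. by rewrite expR_gt1 mulr_gt0. Qed.
Let E0 : 0 < E. Proof. exact: expR_gt0. Qed.
Let EV1 : E^-1 < 1. Proof. by rewrite invf_lt1. Qed.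
Let EV0 : 0 < E^-1. Proof. by rewrite invr_gt0. Qed.

Let UV w : U w * V w = 1.
Proof. by rewrite -cexpD -mulrDl real_complexN subrr mul0r cexp0. Qed.

Let U_real (x : R) : U x%:C = (expR (kap * x))%:C.
Proof. by rewrite /U -real_complexM cexp_real. Qed.

Let V_real (x : R) : V x%:C = (expR (- (kap * x)))%:C.
Proof. by rewrite /V -real_complexM cexp_real mulNr. Qed.

Let Ul : U l%:C = E%:C. Proof. exact: U_real. Qed.
Let Vl : V l%:C = (E^-1)%:C. Proof. by rewrite V_real expRN. Qed.
Let Unl : U (- l)%:C = (E^-1)%:C. Proof. by rewrite U_real mulrN expRN. Qed.
Let Vnl : V (- l)%:C = E%:C. Proof. by rewrite V_real mulrN opprK. Qed.

Let mu_realE (x : R) : mu x%:C = (complex.Re (mu x%:C))%:C.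
Proof. by rewrite [LHS]complexRIE mu_real mul0r addr0. Qed.

Let Y_real (x : R) : complex.Im (Y x%:C) = 0.
Proof. by rewrite /Y U_real V_real mu_realE -!(real_complexB, real_complexM). Qed.

Let d_real (x : R) : complex.Im (d x%:C) = 0.
Proof. by rewrite /d U_real V_real -!real_complexB. Qed.

Let Y_node s : s = l \/ s = - l -> Y s%:C = 0.
Proof.
have D0 : E - E^-1 != 0 by rewrite subr_eq0 gt_eqF// (lt_trans EV1).
rewrite /Y; case=> ->; rewrite ?Ul ?Vl ?Unl ?Vnl mu_realE -!(real_complexB, real_complexM).
- apply/eqP; rewrite eq_complex /= eqxx andbT; apply/eqP; rewrite /lam /c0.
  by move: (E - E^-1) D0 => D D0; field.
- apply/eqP; rewrite eq_complex /= eqxx andbT; apply/eqP; rewrite /lam /c0.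
  by rewrite -(opprB E); move: (E - E^-1) D0 => D D0; field.
Qed.

Let d_node s : s = l \/ s = - l -> d s%:C = 0.
Proof.
rewrite /d; case=> ->; rewrite ?Ul ?Vl ?Unl ?Vnl -!real_complexB.
- by rewrite -addrA -opprD subrr.
- by rewrite -addrA -opprD [E^-1 + E]addrC subrr.
Qed.

Let d_neq0 w : 0 <= complex.Im w <= a -> w != l%:C -> w != (- l)%:C -> d w != 0.
Proof.
move=> /andP[i0 ia] wl wnl.
have Im0 s : 0 <= complex.Im (kap%:C * (w - s%:C)) <= pi.
  rewrite cImM cImD cImN /= oppr0 addr0 mul0r addr0 mulr_ge0 ?(ltW kap0)//=.
  by rewrite -kapa ler_pM2l.
have node s : U w = (expR (kap * s))%:C -> w = s%:C.
  move=> Uw; apply/eqP; rewrite -subr_eq0; apply/eqP.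
  have : kap%:C * (w - s%:C) = 0.
    apply: cexp_eq1 => //; rewrite mulrBr cexpD -/(U w) Uw -real_complexM -real_complexN cexp_real.
    by rewrite -real_complexM -expRD subrr expR0.
  by move=> /eqP; rewrite mulf_eq0 => /orP[/eqP/complexI k0|/eqP//]; move: kap0; rewrite k0 ltxx.
have -> : d w = (E%:C - U w) * (1 - V w * (E^-1)%:C).
  have -> : (E%:C - U w) * (1 - V w * (E^-1)%:C) =
    E%:C - V w * (E%:C * (E^-1)%:C) - U w + U w * V w * (E^-1)%:C by ring.
  by rewrite -real_complexM mulfV ?gt_eqF// UV /d real_complexD; ring.
rewrite mulf_neq0// subr_eq0 eq_sym.
  by apply: contra wl => /eqP /node ->.
apply: contra wnl => /eqP VE; apply/eqP/node.
have -> : U w = U w * (V w * (E^-1)%:C) by rewrite VE mulr1.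
by rewrite mulrA UV mul1r /E mulrN expRN.
Qed.

Let dU w : is_derive w 1 U (kap%:C * U w).
Proof. exact: is_derive_cexp_lin. Qed.

Let dV w : is_derive w 1 V ((- kap)%:C * V w).
Proof. exact: is_derive_cexp_lin. Qed.

Let dd w : is_derive w 1 d (kap%:C * (V w - U w)).
Proof.
apply: is_derive_eq (is_deriveB (is_deriveB (is_derive_cst (E + E^-1)%:C w (1 : R[i])) (dU w)) (dV w)) _.
by rewrite real_complexN; ring.
Qed.

Let Y_holo : holo2 (strip (- b) b) Y.
Proof.
apply: holo2B; first by apply: holo2B mu_holo _; exact: holo2_cst.
apply: holo2M; first exact: holo2_cst.
by apply: holo2B; exact: holo2_cexp_lin.
Qed.

Let d_holo S : holo2 S d.
Proof.
apply: holo2B; last exact: holo2_cexp_lin.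
by apply: holo2B; [exact: holo2_cst|exact: holo2_cexp_lin].
Qed.

Let Z w := Y w / d w.

Let Im_div_real w (D : R) : complex.Im (w / D%:C) = complex.Im w / D.
Proof. by rewrite -real_complexV cImM /= mulr0 add0r. Qed.

(** At a node Y and d both vanish, so Z tends to the quotient of their derivatives,
    which is real because Y and d are real on the real axis. *)
Let near_node (s eps : R) : s = l \/ s = - l -> 0 < eps ->
  \forall w \near s%:C, strip 0 a w -> - complex.Im (Z w) < eps.
Proof.
move=> sl e0.
have Ss : strip (- b) b s%:C by rewrite /strip /= oppr_lt0 andbb (lt_trans a0).
have [Y1 [_ /(_ _ Ss)[dY _]]] := Y_holo.
have d1 : kap%:C * (V s%:C - U s%:C) != 0.
  apply: mulf_neq0; first by rewrite gt_eqF// ltcR.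
  rewrite subr_eq0.
  have EVE : E^-1 < E by exact: lt_trans EV1 E1.
  case: sl => ->; rewrite ?Ul ?Vl ?Unl ?Vnl (inj_eq (@complexI _)).
    by rewrite lt_eqF.
  by rewrite gt_eqF.
have := cvg_quotient_at_zero (Y_node sl) (d_node sl) d1 dY (dd _).
set q := Y1 _ / _ => Zq.
have q0 : complex.Im q = 0.
  have i1 : complex.Im (Y1 s%:C) = 0 by exact: is_derive_real_axis dY.
  have := is_derive_real_axis d_real (dd s%:C).
  rewrite /q; case: (kap%:C * _) => u v /= ->; rewrite complexr0 Im_div_real i1.
  by rewrite mul0r.
have /cvg_complexP/(_ eps e0)/near_complexP[r r0 Hr] := Zq.
apply/near_complexP; exists r => // w wr /andP[w0 _].
have := Hr w wr => /(_ _).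
have ws : w != s%:C by apply: contraTN w0 => /eqP -> /=; rewrite ltxx.
move=> /(_ ws) H; have := le_lt_trans (Im_le_cabs _) H.
by rewrite cImD cImN q0 oppr0 addr0 ltr_norml => /andP[]; rewrite ltrNl.
Qed.

Let near_regular w0 (eps : R) : 0 <= complex.Im w0 <= a -> d w0 != 0 ->
  0 <= complex.Im (Z w0) -> 0 < eps ->
  \forall w \near w0, strip 0 a w -> - complex.Im (Z w) < eps.
Proof.
move=> /andP[i0 ia] dw0 Zw0 e0.
have Sw : strip (- b) b w0.
  by rewrite /strip /= (le_lt_trans ia ab) (lt_le_trans _ i0)// oppr_lt0 (lt_trans a0).
have cY := holo2_continuous Y_holo Sw.
have cd : {for w0, continuous d} by exact: (holo2_continuous (d_holo setT)).
have cZ : {for w0, continuous Z} by exact: cvgM cY (cvgV dw0 cd).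
have /cvgrPdist_lt/(_ _ e0) := continuous_comp cZ (@Im_continuous R (Z w0)).
apply: filterS => w /= + _; rewrite ltr_norml => /andP[_]; lra.
Qed.

Let cexp_pi z : complex.Im z = pi \/ complex.Im z = - pi ->
  cexp z = (- expR (complex.Re z))%:C.
Proof.
by rewrite /cexp; case=> ->; rewrite ?cosN ?sinN cospi sinpi ?oppr0 complexr0
  -real_complexM mulrN1.
Qed.

(** On the upper edge U and V are negative reals, so d is positive and the
    interpolant is real: Im Z has the sign of Im mu. *)
Let Z_top w : complex.Im w = a -> 0 <= complex.Im (Z w).
Proof.
move=> wa; set x := complex.Re w.
have ReU (k : R) : complex.Re (k%:C * w) = k * x by rewrite cReM /= mul0r subr0.
have UE : U w = (- expR (kap * x))%:C.
  by rewrite /U cexp_pi ?ReU//; left; rewrite cImM /= mul0r addr0 wa kapa.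
have VE : V w = (- expR (- kap * x))%:C.
  by rewrite /V cexp_pi ?ReU//; right; rewrite cImM /= mul0r addr0 wa mulNr kapa.
have dE : d w = (E + E^-1 + expR (kap * x) + expR (- kap * x))%:C.
  by rewrite /d UE VE -!real_complexB !opprK.
rewrite /Z dE Im_div_real divr_ge0 ?addr_ge0 ?expR_ge0 ?(ltW E0) ?(ltW EV0)//.
rewrite /Y UE VE -!(real_complexB, real_complexM) !cImD !cImN /= !oppr0 !addr0.
exact: mu_top.
Qed.

(** Z tends to lam at the right end and to - lam at the left end, since
    Y - lam d = mu + O(1) there while d grows exponentially. *)
Let Z_end (eps : R) : 0 < eps -> exists X' : R, forall w, strip 0 a w ->
  X' <= `|complex.Re w| -> - complex.Im (Z w) < eps.
Proof.
move=> e0; pose B := K + `|c0| + `|lam| * (E + E^-1) + 2 * `|lam|.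
pose M := B / eps + 1 + (E + E^-1).
exists (Num.max X (M / kap)) => w Sw; rewrite ge_max => /andP[Xw].
rewrite ler_pdivrMr// => Mw; set x := complex.Re w in Xw Mw *.
have muK := mu_bounded Sw Xw.
have EE : 0 <= E + E^-1 by rewrite addr_ge0 ?ltW.
have B0 : 0 <= B.
  by rewrite !addr_ge0 ?mulr_ge0//; exact: le_trans (cabs_ge0 _) muK.
have ReU (k : R) : complex.Re (k%:C * w) = k * x by rewrite cReM /= mul0r subr0.
have aU : cabs (U w) = expR (kap * x) by rewrite cabs_cexp ReU.
have aV : cabs (V w) = expR (- kap * x) by rewrite cabs_cexp ReU.
have cEE : cabs (E + E^-1)%:C = E + E^-1 by rewrite cabs_real ger0_norm.
have expM : 1 + M <= expR (kap * `|x|).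
  by apply: le_trans (expR_ge1Dx _); rewrite lerD2l mulrC.
(* T is the exponential that blows up at the end considered, W the other one,
   and s = lam or - lam the limit of Z there. *)
have key (T W : R[i]) (s : R) : cabs T = expR (kap * `|x|) -> cabs W <= 1 ->
    `|s| = `|lam| -> d w = (E + E^-1)%:C - T - W ->
    Y w - s%:C * d w = mu w - c0%:C - s%:C * (E + E^-1)%:C + 2 * s%:C * W ->
    - complex.Im (Z w) < eps.
  move=> aT aW sl dE Yd.
  have dgt : B / eps < cabs (d w).
    have h1 := cabs_le_triB T (E + E^-1)%:C.
    have h2 := cabs_le_triB (T - (E + E^-1)%:C) (- W).
    have -> : d w = - (T - (E + E^-1)%:C - - W) by rewrite dE; ring.
    rewrite cabsN; move: h1 h2; rewrite cabsN cEE aT; move: expM aW.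
    by rewrite /M; lra.
  have dw0 : 0 < cabs (d w) by apply: le_lt_trans dgt; rewrite divr_ge0// ltW.
  have ZE : Z w - s%:C = (Y w - s%:C * d w) / d w.
    by rewrite mulrBl mulfK// -cabs_gt0.
  have -> : complex.Im (Z w) = complex.Im (Z w - s%:C).
    by rewrite cImD cImN oppr0 addr0.
  apply: (@le_lt_trans _ _ (cabs (Z w - s%:C))).
    by apply: le_trans (Im_le_cabs _); rewrite -normrN ler_norm.
  rewrite ZE cabs_div ltr_pdivrMr// -ltr_pdivrMl//.
  apply: le_lt_trans dgt; rewrite [B / eps]mulrC ler_pM2l ?invr_gt0// Yd /B.
  apply: le_trans (cabsD _ _) (lerD _ _); last first.
    rewrite !cabsM cabs_real sl -[leRHS]mulr1.
    have -> : cabs 2 = 2 :> R.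
      have -> : (2 : R[i]) = (2 : R)%:C by rewrite -(rmorph_nat (real_complex R)).
      by rewrite cabs_real ger0_norm.
    by rewrite ler_wpM2l// mulr_ge0.
  apply: le_trans (cabsD _ _) (lerD _ _); last first.
    by rewrite cabsN cabsM cabs_real sl cEE.
  by apply: le_trans (cabsD _ _) (lerD _ _) => //; rewrite cabsN cabs_real.
have [x0|x0] := leP 0 x.
- apply: (key (U w) (V w) lam) => //.
  + by rewrite aU ger0_norm.
  + by rewrite aV expR_le1 mulNr oppr_le0 mulr_ge0// ltW.
  + by rewrite /Y /d; ring.
- apply: (key (V w) (U w) (- lam)) => //.
  + by rewrite aV ltr0_norm// mulrN mulNr.
  + by rewrite aU expR_le1 pmulr_rle0// ltW.
  + by rewrite normrN.
  + by rewrite /d; ring.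
  + by rewrite /Y /d real_complexN; ring.
Qed.

(** The maximum principle applied to - Im Z.  On the imaginary axis d is a positive
    real, so that Im Z >= 0 becomes a lower bound on Im mu. *)
Lemma strip_interpolation (y : R) : 0 < y < a ->
  (complex.Re (mu l%:C) - complex.Re (mu (- l)%:C)) * sin (pi / a * y) <=
  complex.Im (mu (0 +i* y)) * (expR (pi / a * l) - (expR (pi / a * l))^-1).
Proof.
move=> /andP[y0 ya].
have Sd w : strip 0 a w -> d w != 0.
  move=> /andP[w0 wa]; apply: d_neq0; rewrite ?(ltW w0) ?(ltW wa)//;
    by apply: contraTN w0 => /eqP ->; rewrite /= ltxx.
have Sab : strip 0 a `<=` strip (- b) b.
  move=> w /andP[w0 wa]; rewrite /strip /= (lt_trans wa ab).
  by rewrite (lt_trans _ w0)// oppr_lt0 (lt_trans a0).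
have hZ : holo2 (strip 0 a) Z.
  by apply: holo2_div => //; exact: holo2W Sab Y_holo.
have H : forall w, strip 0 a w -> - complex.Im (Z w) <= 0.
  apply: (@strip_maximum R 0 a (fun=> 0) (fun w => 'i * Z w)).
  - by move=> w; rewrite cabs0 expr0n /= add0r cReM /= mul0r mul1r sub0r.
  - exact: holo2_cst.
  - by apply: holo2M => //; exact: holo2_cst.
  - move=> eps w0 e0 [w00|w0a].
      have w0E : w0 = (complex.Re w0)%:C by rewrite [LHS]complexRIE w00 mul0r addr0.
      have [sl|nl] := pselect (complex.Re w0 = l \/ complex.Re w0 = - l).
        by rewrite w0E; exact: near_node.
      have dw0 : d w0 != 0.
        apply: d_neq0; rewrite ?w00 ?lexx ?(ltW a0)//.
          by apply/eqP => h; apply: nl; left; rewrite h.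
        by apply/eqP => h; apply: nl; right; rewrite h.
      apply: near_regular => //; first by rewrite w00 lexx ltW.
      have dr : d w0 = (complex.Re (d w0))%:C.
        by rewrite [LHS]complexRIE {2}w0E d_real mul0r addr0.
      by rewrite /Z dr Im_div_real w0E Y_real mul0r.
    apply: near_regular => //; last exact: Z_top.
      by rewrite w0a lexx ltW.
    apply: d_neq0; first by rewrite w0a lexx ltW.
      by apply/eqP => h; move: a0; rewrite -w0a h ltxx.
    by apply/eqP => h; move: a0; rewrite -w0a h ltxx.
  - exact: Z_end.
have Sy : strip 0 a (0 +i* y) by apply/andP.
have := H _ Sy; rewrite oppr_le0.
have UE : U (0 +i* y) = cos (kap * y) +i* sin (kap * y).
  by rewrite -cexp_Ox /U; congr cexp; apply/eqP; rewrite eq_complex /=; apply/andP; split; apply/eqP; ring.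
have VE : V (0 +i* y) = cos (kap * y) +i* - sin (kap * y).
  by rewrite -cosN -sinN -cexp_Ox /V; congr cexp; apply/eqP; rewrite eq_complex /=; apply/andP; split; apply/eqP; ring.
have dE : d (0 +i* y) = (E + E^-1 - 2 * cos (kap * y))%:C.
  by rewrite /d UE VE; apply/eqP; rewrite eq_complex /=; apply/andP; split; apply/eqP; ring.
have EE2 : 2 < E + E^-1.
  rewrite -subr_gt0 (_ : _ - _ = (E - 1) ^+ 2 / E); last by field; rewrite gt_eqF.
  by rewrite divr_gt0// exprn_gt0// subr_gt0.
have d0 : 0 < E + E^-1 - 2 * cos (kap * y).
  by have := cos_le1 (kap * y); lra.
rewrite /Z dE Im_div_real pmulr_lge0 ?invr_gt0//.
have EV : 0 < E - E^-1 by rewrite subr_gt0 (lt_trans EV1).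
have -> : complex.Im (Y (0 +i* y)) =
    complex.Im (mu (0 +i* y)) - 2 * lam * sin (kap * y).
  rewrite /Y UE VE; case: (mu _) => p q /=; ring.
rewrite subr_ge0 -(ler_pM2r EV).
suff -> : 2 * lam * sin (kap * y) * (E - E^-1) =
    (complex.Re (mu l%:C) - complex.Re (mu (- l)%:C)) * sin (kap * y) by [].
by rewrite /lam; move: (E - E^-1) (lt0r_neq0 EV) => D D0; field.
Qed.

End StripInterpolation.

(** * Polynomials in the exponential *)

Section ExpPoly.
Variable R : realType.
Implicit Types (z w : R[i]) (p : {poly R[i]}) (S : set R[i]).

Definition epoly p w := p.[cexp w].

(** The operator X d/dX, which is d/dw on polynomials in e^w. *)
Definition eulerd p := 'X * p^`().

Lemma is_derive_epoly p w : is_derive w 1 (epoly p) (epoly (eulerd p) w).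
Proof.
rewrite /epoly /eulerd hornerM hornerX mulrC.
exact: is_derive_chain (is_derive_cexp w) (is_derive_horner p (cexp w)).
Qed.

Lemma holo2_epoly S p : holo2 S (epoly p).
Proof.
exists (epoly (eulerd p)), (epoly (eulerd (eulerd p))) => w _.
by split; exact: is_derive_epoly.
Qed.

Lemma holo2_shift S (F : R[i] -> R[i]) (c : R[i]) :
  holo2 setT F -> holo2 S (fun w => F (w - c)).
Proof.
move=> [F1 [F2 dF]]; exists (fun w => F1 (w - c)), (fun w => F2 (w - c)) => w _.
have [f1 f2] := dF (w - c) I.
have ds : is_derive w 1 (fun w => w - c) 1.
  by apply: is_derive_eq (is_deriveB (is_derive_id w 1) (is_derive_cst c w 1)) _; rewrite subr0.
by split; [have := is_derive_chain ds f1|have := is_derive_chain ds f2]; rewrite mulr1.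
Qed.

Lemma horner_conj p z : (forall i, 0 <= p`_i) -> p.[conjc z] = conjc p.[z].
Proof.
move=> p0; have {1}-> : p = map_poly (@conjc R) p.
  apply/polyP => i; rewrite coef_map /=; have := p0 i.
  by case: (p`_i) => u v; rewrite lecE /= => /andP[/eqP -> _]; rewrite oppr0.
by rewrite horner_map.
Qed.

Lemma cabs_conj z : cabs z^* = cabs z.
Proof. by case: z => x y; rewrite /cabs /= sqrrN. Qed.

Lemma cabs_epoly_conj p w : (forall i, 0 <= p`_i) ->
  cabs (epoly p w^*) = cabs (epoly p w).
Proof. by move=> p0; rewrite /epoly -conj_cexp horner_conj// cabs_conj. Qed.

Lemma epoly_real p (x : R) : (forall i, 0 <= p`_i) ->
  complex.Im (epoly p x%:C) = 0.
Proof.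
move=> p0; have := horner_conj (cexp x%:C) p0; rewrite conj_cexp conjc_real.
by rewrite /epoly; case: (p.[_]) => u v [] /eqP; rewrite -addr_eq0 -mulr2n mulrn_eq0 => /eqP.
Qed.

Lemma eulerd_ge0 p : (forall i, 0 <= p`_i) -> forall i, 0 <= (eulerd p)`_i.
Proof.
move=> p0 i; rewrite /eulerd coefXM; case: i => [|i] //=.
by rewrite coef_deriv mulrn_wge0.
Qed.

(** The triangle inequality, with equality on the positive axis because the
    coefficients are nonnegative. *)
Lemma cabs_epoly_le p w : (forall i, 0 <= p`_i) ->
  cabs (epoly p w) <= cabs (epoly p (complex.Re w)%:C).
Proof.
move=> p0; have H : `|epoly p w| <= epoly p (complex.Re w)%:C.
  rewrite /epoly cexp_real -cabs_cexp -(norm_cabs (cexp w)) !horner_coef.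
  apply: (le_trans (ler_norm_sum _ _ _)); apply: ler_sum => i _.
  by rewrite normrM normrX (ger0_norm (p0 i)).
have H0 : 0 <= epoly p (complex.Re w)%:C by apply: le_trans H; exact: normr_ge0.
by move: H; rewrite -[leRHS](ger0_norm H0) !norm_cabs lecR.
Qed.

Lemma poly_split p : exists rs : seq R[i],
  p = lead_coef p *: \prod_(z <- rs) ('X - z%:P).
Proof. by have [rs ->] := closed_field_poly_normal p; exists rs; rewrite lead_coefZ (monicP (monic_prod_XsubC _ _ _)) mulr1. Qed.

Lemma size_prod_split p rs : p != 0 ->
  p = lead_coef p *: \prod_(z <- rs) ('X - z%:P) -> size p = (size rs).+1.
Proof.
by move=> p0 pE; rewrite pE size_scale ?lead_coef_eq0// size_prod_XsubC.
Qed.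

Lemma root_split p rs z : p != 0 ->
  p = lead_coef p *: \prod_(z <- rs) ('X - z%:P) -> z \in rs -> root p z.
Proof.
by move=> p0 pE zrs; rewrite pE rootZ ?lead_coef_eq0// root_prod_XsubC.
Qed.

Lemma horner_split p rs z :
  p = lead_coef p *: \prod_(z <- rs) ('X - z%:P) ->
  p.[z] = lead_coef p * \prod_(t <- rs) (z - t).
Proof.
move=> {1}->; rewrite hornerZ horner_prod; congr (_ * _).
by apply: eq_bigr => t _; rewrite hornerXsubC.
Qed.

Lemma log_deriv_split p rs z :
  p = lead_coef p *: \prod_(z <- rs) ('X - z%:P) -> p.[z] != 0 ->
  (eulerd p).[z] / p.[z] = \sum_(t <- rs) z / (z - t).
Proof.
move=> pE; rewrite (horner_split z pE) mulf_eq0 negb_or => /andP[l0 P0].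
rewrite /eulerd hornerM hornerX {1}pE derivZ hornerZ mulrCA -mulf_div divff// mul1r.
rewrite -mulrA -mulr_sumr; congr (_ * _).
elim: rs P0 {pE} => [_|t rs IH]; rewrite ?(big_nil, big_cons).
  by rewrite derivC horner0 mul0r.
rewrite mulf_eq0 negb_or => /andP[t0 P0].
rewrite derivM derivXsubC mul1r hornerD !hornerM -(IH P0) hornerXsubC.
have -> : (\prod_(j <- rs) ('X - j%:P)).[z] = \prod_(j <- rs) (z - j).
  by rewrite horner_prod; apply: eq_bigr => j _; rewrite hornerXsubC.
by field; rewrite t0 P0.
Qed.

End ExpPoly.

Section FarFromZeros.
Variable R : realType.
Implicit Types (z w t : R[i]) (p : {poly R[i]}).

(** For s < 1 this says that e^w is far from the zero t on the scale m = max(|t|, e^(Re w)):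
    outside the annulus of zeros, one of |t|, e^(Re w) is at most s times the other. *)
Lemma far_from_zero (rho : R) t w : 1 <= rho -> rho^-1 <= cabs t <= rho ->
  let s := rho * expR (- `|complex.Re w|) in
  exists2 m : R, cabs (cexp w) <= m & forall w', complex.Re w' = complex.Re w ->
    m * (1 - s) <= cabs (cexp w' - t) <= m * (1 + s).
Proof.
move=> rho1 /andP[t1 t2] s; set x := complex.Re w in s *.
have rho0 : 0 < rho by apply: lt_le_trans rho1.
have s0 : 0 < s by rewrite mulr_gt0// expR_gt0.
have tri w' : complex.Re w' = x ->
   [/\ expR x - cabs t <= cabs (cexp w' - t), cabs t - expR x <= cabs (cexp w' - t)
     & cabs (cexp w' - t) <= expR x + cabs t].
  move=> w'x; rewrite -w'x -cabs_cexp; split; first exact: cabs_le_triB.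
    by rewrite [leRHS]cabsB; exact: cabs_le_triB.
  by rewrite -(cabsN t) cabsD.
have [x0|x0] := leP 0 x.
  exists (expR x); first by rewrite cabs_cexp.
  have sE : expR x * s = rho by rewrite /s ger0_norm// mulrCA -expRD subrr expR0 mulr1.
  by move=> w' /tri[h1 h2 h3]; rewrite mulrBr mulrDr mulr1 sE; apply/andP; split; lra.
have sE : s = rho * expR x by rewrite /s ltr0_norm// opprK.
have tx : expR x <= cabs t * s.
  rewrite sE mulrA ler_peMl ?expR_ge0//.
  by rewrite -ler_pdivrMr// div1r.
exists (Num.max (cabs t) (expR x)); first by rewrite cabs_cexp le_max lexx orbT.
have [xt|tx'] := leP (expR x) (cabs t).
  by move=> w' /tri[h1 h2 h3]; rewrite mulrBr mulrDr mulr1; apply/andP; split; lra.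
move=> w' /tri[h1 h2 h3]; rewrite mulrBr mulrDr mulr1.
have : cabs t * s <= expR x * s by rewrite ler_pM2r// ltW.
by move=> h; apply/andP; split; lra.
Qed.

End FarFromZeros.

(** * The logarithmic derivative *)

Section LogDerivative.
Variable R : realType.
Implicit Types (z w t : R[i]).

Lemma ratio_near1 (n : nat) (eps : R) : 0 < eps ->
  exists2 r : R, 0 < r <= 1 / 2 & forall s : R, 0 <= s < r ->
    (((1 + s) / (1 - s)) ^+ n) ^+ 2 < 1 + eps.
Proof.
move=> e0; pose f (s : R) := (1 + s) / (1 - s).
have cf : f @ (0 : R) --> f 0.
  apply: cvgM; first by apply: cvgD; [exact: cvg_cst|exact: cvg_id].
  apply: cvgV; first by rewrite subr0 oner_neq0.
  by apply: cvgB; [exact: cvg_cst|exact: cvg_id].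
have := cvg_comp f (fun x => x ^+ (n * 2)) cf (@exprn_continuous _ _ _).
move=> /cvgrPdist_lt /(_ _ e0) /nbhs_normP[r /= r0 Hr].
exists (Num.min r (1 / 2)); first by rewrite lt_min r0 ge_min lexx orbT /= divr_gt0.
move=> s /andP[s0]; rewrite lt_min => /andP[sr _].
have := Hr s; rewrite /= sub0r normrN ger0_norm// => /(_ sr).
rewrite /f addr0 subr0 divr1 expr1n -exprM ltr_norml => /andP[]; lra.
Qed.

Lemma cabs_prod_le (C : R) (rs : seq R[i]) u v : 0 <= C ->
  (forall t, t \in rs -> cabs (u - t) <= C * cabs (v - t)) ->
  cabs (\prod_(t <- rs) (u - t)) <= C ^+ size rs * cabs (\prod_(t <- rs) (v - t)).
Proof.
move=> C0; elim: rs => [|t rs IH] H; first by rewrite !big_nil expr0 mul1r.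
rewrite !big_cons !cabsM exprS mulrACA.
apply: ler_pM; rewrite ?cabs_ge0 ?H ?inE ?eqxx//.
by apply: IH => t' t'rs; apply: H; rewrite inE t'rs orbT.
Qed.

(** A derivative c > 0 at 0 would give S(t) > S(-t) for small t > 0. *)
Lemma decreasing_at_reflection (S : R -> R) (c r : R) : 0 < r ->
  is_derive (0 : R) 1 S c -> (forall t : R, 0 < t < r -> S t <= S (- t)) -> c <= 0.
Proof.
move=> r0 dS HS; rewrite leNgt; apply/negP => c0.
have /nbhs_normP[e /= e0 He] := is_derive_real_near dS (divr_gt0 c0 (ltr0Sn R 1)).
pose t := Num.min e r / 2.
have m0 : 0 < Num.min e r by rewrite lt_min e0 r0.
have t0 : 0 < t by rewrite divr_gt0.
have : t < Num.min e r by rewrite ltr_pdivrMr// ltr_pMr// ltr1n.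
rewrite lt_min => /andP[te tr].
have := HS t; rewrite t0 tr => /(_ isT).
have := He t; have := He (- t).
rewrite /= !sub0r !normrN gtr0_norm// => /(_ te) + /(_ te).
rewrite !add0r ler_norml => /andP[_ h1]; rewrite ler_norml => /andP[h2 _] h3.
have : 0 < t * c by rewrite mulr_gt0.
by move: h1 h2; rewrite mulNr; lra.
Qed.

Lemma is_derive_abs2_vertical (p : {poly R[i]}) w0 (s : R) :
  epoly p (w0 + s%:C * 'i) != 0 ->
  is_derive s 1 (fun s : R => cabs (epoly p (w0 + s%:C * 'i)) ^+ 2)
    (- 2 * cabs (epoly p (w0 + s%:C * 'i)) ^+ 2 *
     complex.Im (epoly (eulerd p) (w0 + s%:C * 'i) / epoly p (w0 + s%:C * 'i))).
Proof.
set w := w0 + _ => pw.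
have dA := is_derive_Re_line (is_derive_epoly p w).
have dB := is_derive_Im_line (is_derive_epoly p w).
have := is_deriveD (is_deriveM dA dA) (is_deriveM dB dB) => H.
under eq_fun do rewrite cabs_sqr !expr2.
apply: is_derive_eq H _; rewrite -/w cabs_sqr /GRing.scale /=.
rewrite -{1 2 3 4}(divfK pw (epoly (eulerd p) w)).
case: (epoly (eulerd p) w / epoly p w) => q1 q2.
by case: (epoly p w) => u1 u2 /=; ring.
Qed.

Variables (p : {poly R[i]}) (n : nat) (rho a : R).
Hypothesis p_ge0 : forall i, 0 <= p`_i.
Hypothesis p_size : size p = n.+1.
Hypotheses (a0 : 0 < a) (rho1 : 1 <= rho).
Hypothesis p_nz : forall w, strip (- (2 * a)) (2 * a) w -> epoly p w != 0.
Hypothesis p_ann : forall z, root p z -> rho^-1 <= cabs z <= rho.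

(** At a real point x, this is the mean of the law with weights proportional to
    p`_k e^(kx). *)
Definition mu w := epoly (eulerd p) w / epoly p w.

Let p0 : p != 0. Proof. by rewrite -size_poly_eq0 p_size. Qed.
Let rho0 : 0 < rho. Proof. exact: lt_le_trans rho1. Qed.

Let s_lt (r x : R) : 0 < r -> rho / r <= x -> rho * expR (- x) < r.
Proof.
move=> r0 rx; rewrite expRN ltr_pdivrMr ?expR_gt0//.
have : rho <= r * x by rewrite mulrC -ler_pdivrMr.
have := expR_ge1Dx x => h h'; apply: le_lt_trans h' _.
by rewrite ltr_pM2l//; lra.
Qed.

(** At both ends every factor of the product over the zeros has nearly the same
    modulus at w and w', uniformly in the imaginary parts. *)
Let epoly_ends (eps : R) : 0 < eps -> exists X : R, forall w w',
  complex.Re w' = complex.Re w -> X <= `|complex.Re w| -> epoly p w' != 0 ->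
  cabs (epoly p w / epoly p w') ^+ 2 < 1 + eps.
Proof.
move=> e0; have [r /andP[r0 r2] Hr] := ratio_near1 n e0.
have [rs pE] := poly_split p.
have sz : size rs = n by have := size_prod_split p0 pE; rewrite p_size => -[].
exists (rho / r) => w w' ww' wX pw'.
pose s := rho * expR (- `|complex.Re w|).
have s0 : 0 <= s by rewrite mulr_ge0 ?expR_ge0// ltW.
have sr : s < r by exact: s_lt.
have s1 : 0 < 1 - s by lra.
have C0 : 0 <= (1 + s) / (1 - s) by apply: divr_ge0; [exact: addr_ge0|exact: ltW].
apply: le_lt_trans (Hr s _); last by rewrite s0.
rewrite ler_sqr ?nnegrE ?cabs_ge0 ?exprn_ge0//.
rewrite cabs_div ler_pdivrMr ?cabs_gt0// /epoly !(horner_split _ pE) !cabsM.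
rewrite mulrCA ler_wpM2l ?cabs_ge0// -sz.
apply: cabs_prod_le => //.
move=> t trs; have [m _ Hm] := far_from_zero w rho1 (p_ann (root_split p0 pE trs)).
have /andP[_ h1] := Hm w erefl; have /andP[h2 _] := Hm w' ww'.
apply: le_trans h1 _; rewrite -/s mulrAC ler_pdivlMr// mulrAC.
by rewrite [leRHS]mulrC ler_wpM2r// addr_ge0.
Qed.

(** On the line Im w = a this is complex conjugation. *)
Let reflect (w : R[i]) : R[i] := w - (0 +i* (2 * a)).

Let holo2_reflect_ratio : holo2 (strip 0 (4 * a)) (fun w => epoly p w / epoly p (reflect w)).
Proof.
have a_gt0 := a0; apply: holo2_div; last by apply: holo2_shift; exact: holo2_epoly.
  move=> w /andP[w0 wa]; apply: p_nz; rewrite /strip /= cImD cImN /=.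
  by apply/andP; split; lra.
exact: holo2_epoly.
Qed.

(** The quotient of the two sides has modulus 1 on Im w = a, where reflect w is the
    conjugate of w, and at most 1 on Im w = 2a, where reflect w = Re w and the
    coefficients are nonnegative. *)
Lemma epoly_le_reflect w : strip a (2 * a) w ->
  cabs (epoly p w) <= cabs (epoly p (reflect w)).
Proof.
have a_gt0 := a0; pose F w := epoly p w / epoly p (reflect w).
have SS w0 : a <= complex.Im w0 <= 2 * a -> strip 0 (4 * a) w0.
  by move=> /andP[? ?]; rewrite /strip /=; apply/andP; split; lra.
have nz w0 : a <= complex.Im w0 <= 2 * a -> 0 < cabs (epoly p (reflect w0)).
  move=> /andP[? ?]; rewrite cabs_gt0; apply: p_nz.
  by rewrite /strip /= cImD cImN /=; apply/andP; split; lra.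
have H : forall w, strip a (2 * a) w -> cabs (F w) ^+ 2 - 1 <= 0.
  apply: (@strip_maximum R a (2 * a) F (fun=> -1)).
  - by move=> w0.
  - apply: holo2W holo2_reflect_ratio => w0 /andP[h1 h2]; apply: SS.
    by rewrite !ltW.
  - exact: holo2_cst.
  - move=> eps w0 e0 w0E.
    have w0a : a <= complex.Im w0 <= 2 * a.
      by case: w0E => ->; rewrite lexx ?andbT; lra.
    have F1 : cabs (F w0) <= 1.
      rewrite cabs_div ler_pdivrMr ?nz// mul1r.
      case: w0E => w0E.
        rewrite -(cabs_epoly_conj (reflect w0))//.
        have -> // : conjc (reflect w0) = w0.
        move: w0E; rewrite /reflect; case: w0 {w0a} => x y /= ->.
        by apply/eqP; rewrite eq_complex /=; apply/andP; split; apply/eqP; ring.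
      have -> : reflect w0 = (complex.Re w0)%:C.
        move: w0E; rewrite /reflect; case: w0 {w0a} => x y /= ->.
        by apply/eqP; rewrite eq_complex /=; apply/andP; split; apply/eqP; ring.
      exact: cabs_epoly_le.
    have cF := holo2_continuous holo2_reflect_ratio (SS _ w0a).
    have c1 := continuous_comp cF (@cabs_continuous R _).
    have c2 : {for w0, continuous (fun v => cabs (F v) * cabs (F v))}.
      exact: (cvgM c1 c1).
    have /cvgrPdist_lt/(_ _ e0) := c2.
    apply: filterS => v /= + _; rewrite ltr_norml => /andP[+ _].
    have : cabs (F w0) * cabs (F w0) <= 1.
      by rewrite -[leRHS]mulr1 ler_pM ?cabs_ge0.
    rewrite /F expr2; lra.
  - move=> eps e0; have [X HX] := epoly_ends e0; exists X => w0 /andP[w1 w2] w0X.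
    rewrite ltrBlDl; apply: HX w0X _.
      by rewrite cReD cReN /= subr0.
    by rewrite -cabs_gt0 nz// !ltW.
move=> Sw; have := H w Sw; rewrite subr_le0 -[leRHS](expr1n _ 2%N).
rewrite ler_sqr ?nnegrE ?cabs_ge0// cabs_div ler_pdivrMr ?mul1r//.
by apply: nz; case/andP: Sw => ? ?; rewrite !ltW.
Qed.

(** By [epoly_le_reflect], |g|^2 just above the line Im w = a is at most |g|^2 just
    below it, so its vertical derivative - 2 |g|^2 Im mu is nonpositive on the line. *)
Lemma Im_mu_top w : complex.Im w = a -> 0 <= complex.Im (mu w).
Proof.
move=> wa; have a_gt0 := a0.
have pw : epoly p w != 0.
  apply: p_nz; rewrite /strip /= wa; apply/andP; split; lra.
have := @is_derive_abs2_vertical p w 0; rewrite mul0r addr0 => /(_ pw) dS.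
have := decreasing_at_reflection a0 dS.
rewrite !mulNr -mulrA oppr_le0 pmulr_rge0// pmulr_rge0 ?exprn_gt0 ?cabs_gt0//.
apply=> t /andP[t0 ta].
rewrite ler_sqr ?nnegrE ?cabs_ge0//.
rewrite -[leRHS]cabs_epoly_conj//.
have -> : conjc (w + (- t)%:C * 'i) = reflect (w + t%:C * 'i).
  move: wa; rewrite /reflect; case: (w) => x y /= ->.
  by apply/eqP; rewrite eq_complex /=; apply/andP; split; apply/eqP; ring.
apply: epoly_le_reflect.
by rewrite /strip /= cImD /= wa mul0r addr0 mulr1; apply/andP; split; lra.
Qed.

Lemma mu_holo : holo2 (strip (- (2 * a)) (2 * a)) mu.
Proof. by apply: holo2_div; [exact: p_nz|exact: holo2_epoly|exact: holo2_epoly]. Qed.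

Lemma mu_real (x : R) : complex.Im (mu x%:C) = 0.
Proof.
have e1 := epoly_real x p_ge0; have e2 := epoly_real x (eulerd_ge0 p_ge0).
have realE z : complex.Im z = 0 -> z = (complex.Re z)%:C.
  by move=> z0; rewrite [LHS]complexRIE z0 mul0r addr0.
by rewrite /mu (realE _ e1) (realE _ e2) -real_complexV -real_complexM.
Qed.

Lemma mu_bounded w : strip (- (2 * a)) (2 * a) w -> 2 * rho <= `|complex.Re w| ->
  cabs (mu w) <= 2 * n%:R.
Proof.
move=> Sw wX; have [rs pE] := poly_split p.
have sz : size rs = n by have := size_prod_split p0 pE; rewrite p_size => -[].
rewrite /mu /epoly (log_deriv_split pE) ?p_nz// -sz {sz}.
have term t : t \in rs -> cabs (cexp w / (cexp w - t)) <= 2.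
  move=> trs.
  have [m wm /(_ w erefl)/andP[h _]] :=
    far_from_zero w rho1 (p_ann (root_split p0 pE trs)).
  have s2 : rho * expR (- `|complex.Re w|) < 1 / 2.
    by apply: s_lt; rewrite ?divr_gt0// div1r invrK mulrC.
  have m0 : 0 < m by apply: lt_le_trans wm; rewrite cabs_cexp expR_gt0.
  have h2 : m / 2 <= cabs (cexp w - t).
    by apply: le_trans h; rewrite ler_pM2l//; lra.
  rewrite cabs_div ler_pdivrMr; last by apply: lt_le_trans h2; rewrite divr_gt0.
  by apply: le_trans wm _; rewrite mulrC -ler_pdivrMr.
elim: rs term {pE} => [|t rs IH] term; first by rewrite big_nil cabs0 mulr_ge0.
rewrite big_cons; apply: le_trans (cabsD _ _) _.
rewrite /= -[(size _).+1%:R]natr1 mulrDr mulr1 [leRHS]addrC.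
rewrite lerD ?term ?inE ?eqxx// IH// => t' t'rs.
by apply: term; rewrite inE t'rs orbT.
Qed.

Lemma mu_split : exists2 rs : seq R[i], size rs = n &
  (forall t, t \in rs -> rho^-1 <= cabs t <= rho) /\
  forall x : R, mu x%:C = \sum_(t <- rs) (expR x)%:C / ((expR x)%:C - t).
Proof.
have [rs pE] := poly_split p; exists rs.
  by have := size_prod_split p0 pE; rewrite p_size => -[].
split=> [t trs|x]; first exact: p_ann (root_split p0 pE trs).
have px : epoly p x%:C != 0.
  by apply: p_nz; rewrite /strip /= oppr_lt0 andbb mulr_gt0.
by rewrite /mu /epoly (log_deriv_split pE px) cexp_real.
Qed.

(** Re (r / (r - t)) lies above or below r / (r + |t|) according as r > |t| or r < |t|;
    the two agree when t is negative. *)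
Lemma Re_ratio_sub (r : R) t : 0 < r -> t != r%:C ->
  complex.Re (r%:C / (r%:C - t)) - r / (r + cabs t) =
  r * (r - cabs t) * (cabs t + complex.Re t) / (cabs (r%:C - t) ^+ 2 * (r + cabs t)).
Proof.
move=> r0 tr.
have m0 := cabs_ge0 t; have m2 := cabs_sqr t.
have N0 : cabs (r%:C - t) != 0 by rewrite cabs_eq0 subr_eq0 eq_sym.
have rm : r + cabs t != 0 by rewrite gt_eqF// ltr_pwDl.
have N2 := cabs_sqr (r%:C - t).
have -> : complex.Re (r%:C / (r%:C - t)) =
    r * (r - complex.Re t) / cabs (r%:C - t) ^+ 2.
  by rewrite N2; case: (t) => t1 t2 /=; rewrite !mul0r subr0 mulrA.
have {N2} : cabs (r%:C - t) ^+ 2 = r ^+ 2 - 2 * r * complex.Re t + cabs t ^+ 2.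
  by rewrite N2 m2; case: (t) => t1 t2 /=; ring.
move: (cabs (r%:C - t)) (cabs t) (complex.Re t) N0 rm {tr m0 m2} => N m x N0 rm N2.
apply: (mulIf (expf_neq0 2 N0)); apply: (mulIf rm).
have -> : (r * (r - x) / N ^+ 2 - r / (r + m)) * N ^+ 2 * (r + m) =
  r * (r - x) * (r + m) - r * N ^+ 2 by field; rewrite N0 rm.
have -> : r * (r - m) * (m + x) / (N ^+ 2 * (r + m)) * N ^+ 2 * (r + m) =
  r * (r - m) * (m + x) by field; rewrite N0 rm.
by rewrite N2; ring.
Qed.

Lemma Re_sum_ge (c : R) (rs : seq R[i]) (f : R[i] -> R[i]) :
  (forall t, t \in rs -> c <= complex.Re (f t)) ->
  (size rs)%:R * c <= complex.Re (\sum_(t <- rs) f t).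
Proof.
elim: rs => [|t rs IH] H; first by rewrite big_nil mul0r.
rewrite big_cons cReD /= -[(size _).+1%:R]natr1 mulrDl mul1r addrC.
rewrite lerD ?H ?inE ?eqxx// IH// => t' t'rs; apply: H.
by rewrite inE t'rs orbT.
Qed.

(** By [Re_ratio_sub], each zero contributes at least e^delta / (e^delta + 1) to mu at
    the radius rho e^delta, outside all zeros, and at most 1 / (e^delta + 1) at the
    radius 1 / (rho e^delta), inside all zeros. *)
Lemma mu_spread (delta : R) : 0 < delta ->
  n%:R * ((expR delta - 1) / (expR delta + 1)) <=
  complex.Re (mu (ln rho + delta)%:C) - complex.Re (mu (- (ln rho + delta))%:C).
Proof.
move=> d0; have [rs <- [rs_ann muE]] := mu_split.
rewrite -cReN -cReD !muE -sumrB; apply: Re_sum_ge => t /rs_ann /andP[t1 t2].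
rewrite expRN expRD lnK ?posrE//; set q := expR delta.
have q1 : 1 < q by rewrite expR_gt1.
have q0 : 0 < q by lra.
have r0 := rho0; have v0 : 0 < rho^-1 by rewrite invr_gt0.
have t0 : 0 < cabs t by exact: lt_le_trans t1.
have rq : rho < rho * q by rewrite ltr_pMr.
have rq0 : 0 < rho * q by rewrite mulr_gt0.
have rv : (rho * q)^-1 < rho^-1 by rewrite ltf_pV2 ?posrE.
have rv0 : 0 < (rho * q)^-1 by rewrite invr_gt0.
have re : 0 <= cabs t + complex.Re t.
  have := Re_le_cabs t; rewrite ler_norml => /andP[+ _]; lra.
have ne (r : R) : 0 < r -> cabs t != r -> t != r%:C.
  by move=> r_gt0; apply: contra => /eqP ->; rewrite cabs_real gtr0_norm.
have h1 := Re_ratio_sub rq0 (ne _ rq0 (negbT (lt_eqF (le_lt_trans t2 rq)))).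
have h2 := Re_ratio_sub rv0 (ne _ rv0 (negbT (gt_eqF (lt_le_trans rv t1)))).
have g1 : q / (q + 1) <= rho * q / (rho * q + cabs t).
  by rewrite ler_pdivrMr ?addr_gt0// mulrAC ler_pdivlMr ?addr_gt0//; nra.
have g2 : (rho * q)^-1 / ((rho * q)^-1 + cabs t) <= 1 / (q + 1).
  rewrite ler_pdivrMr ?addr_gt0// mulrAC ler_pdivlMr ?addr_gt0// mul1r mulrDr mulr1.
  by rewrite invfM -mulrA mulVf ?gt_eqF// mulr1 addrC lerD2l.
have k1 : 0 <= complex.Re ((rho * q)%:C / ((rho * q)%:C - t)) - rho * q / (rho * q + cabs t).
  rewrite h1 divr_ge0 ?mulr_ge0 ?exprn_ge0 ?cabs_ge0// ?subr_ge0; lra.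
have k2 : complex.Re ((rho * q)^-1%:C / ((rho * q)^-1%:C - t)) - (rho * q)^-1 / ((rho * q)^-1 + cabs t) <= 0.
  rewrite h2; apply: mulr_le0_ge0.
    by apply: mulr_le0_ge0 => //; apply: mulr_ge0_le0; lra.
  by rewrite invr_ge0 mulr_ge0 ?exprn_ge0 ?cabs_ge0//; lra.
rewrite cReD cReN mulrBl; lra.
Qed.

End LogDerivative.

(** * Gaussian decay on the imaginary axis *)

Section Decay.
Variable R : realType.

Lemma sin_ge_half (t : R) : 0 <= t <= pi / 4 -> t / 2 <= sin t.
Proof.
move=> /andP[t0 tpi].
have cos_half (x : R) : 0 <= x <= pi / 4 -> 1 / 2 <= cos x.
  move=> /andP[x0 xpi]; have pi0 := pi_ge0 R.
  have c0 : 0 <= cos x by apply: cos_ge0_pihalf; apply/andP; split; lra.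
  have : 0 <= cos (x *+ 2) by apply: cos_ge0_pihalf; apply/andP; split; lra.
  rewrite cos_mulr2n => h; nra.
have [|c /[!in_itv]/= /andP[c0 ct]] := @MVT_segment R sin cos 0 t t0.
  by apply: derivable_within_continuous => x _.
rewrite sin0 !subr0 => ->; rewrite [leLHS]mulrC ler_wpM2r//.
by rewrite -div1r cos_half// c0 (le_trans ct).
Qed.

Variables (p : {poly R[i]}) (n : nat) (rho delta : R).
Hypothesis p_ge0 : forall i, 0 <= p`_i.
Hypothesis p_size : size p = n.+1.
Hypotheses (d0 : 0 < delta) (dpi : delta <= pi) (rho1 : 1 <= rho).
Hypothesis p_nz : forall w, strip (- delta) delta w -> epoly p w != 0.
Hypothesis p_ann : forall z, root p z -> rho^-1 <= cabs z <= rho.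
Hypothesis p1 : p.[1] = 1.

(** The factor expR (- (2 pi / delta) ln rho) is rho^(- 2 pi / delta), and
    expR (2 pi) is what remains of e^(pi l / a) for l = ln rho + delta and a = delta / 2. *)
Definition decay_rate : R :=
  n%:R * (pi / ((expR pi + 1) * expR (2 * pi))) * expR (- (2 * pi / delta * ln rho)).

(** [strip_interpolation] with a = delta / 2 and l = ln rho + delta, where
    delta <= pi bounds the spread (e^delta - 1) / (e^delta + 1) below by
    delta / (e^pi + 1), and y <= delta / 8 keeps pi y / a within [0, pi / 4]. *)
Lemma Im_mu_lower (y : R) : 0 < y <= delta / 8 ->
  decay_rate * y <= complex.Im (mu p (0 +i* y)).
Proof.
move=> /andP[y0 yd]; have d_gt0 := d0.
have a0 : 0 < delta / 2 by rewrite divr_gt0.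
have a2 : 2 * (delta / 2) = delta by field.
have nz w : strip (- (2 * (delta / 2))) (2 * (delta / 2)) w -> epoly p w != 0.
  by rewrite a2; exact: p_nz.
have ad : delta / 2 < delta by lra.
have rho0 : 0 < rho by apply: lt_le_trans rho1.
have l0 : 0 < ln rho + delta by rewrite ltr_wpDl// ln_ge0.
have hol : holo2 (strip (- delta) delta) (mu p).
  by have := mu_holo nz; rewrite a2.
have bnd w : strip 0 (delta / 2) w -> 2 * rho <= `|complex.Re w| ->
    cabs (mu p w) <= 2 * n%:R.
  move=> /andP[w0 w1]; apply: (mu_bounded p_size rho1 nz p_ann).
  by rewrite a2; apply/andP; split; lra.
have yd' : 0 < y < delta / 2 by rewrite y0 /=; lra.
have := strip_interpolation a0 ad l0 hol (mu_real p_ge0)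
  (fun w => @Im_mu_top _ p n rho _ p_ge0 p_size a0 rho1 nz p_ann w) bnd yd'.
have spread := mu_spread p_size a0 rho1 nz p_ann d0.
set D := complex.Re _ - complex.Re _ in spread *.
have -> : pi / (delta / 2) * (ln rho + delta) = 2 * pi / delta * ln rho + 2 * pi.
  by field; rewrite gt_eqF.
set E := expR _; set I := complex.Im _.
have pi0 := pi_gt0 R.
have E1 : 1 < E.
  rewrite expR_gt1; apply: ltr_wpDl; last by rewrite mulr_gt0.
  by rewrite mulr_ge0 ?ln_ge0// ltW// divr_gt0// mulr_gt0.
have E0 : 0 < E by apply: expR_gt0.
have EV : E^-1 < E by apply: (lt_trans _ E1); rewrite invf_lt1.
have EV0 : 0 < E^-1 by rewrite invr_gt0.
have S : pi / delta * y <= sin (pi / (delta / 2) * y).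
  have -> : pi / delta * y = (pi / (delta / 2) * y) / 2 by field; rewrite gt_eqF.
  apply: sin_ge_half; rewrite !mulr_ge0 ?invr_ge0 ?(ltW y0) ?(ltW pi0) ?(ltW a0)//=.
  rewrite mulrAC ler_pdivrMr// mulrAC ler_pdivlMr//.
  by have : pi * y <= pi * (delta / 8) by [rewrite ler_pM2l]; lra.
have Dl : n%:R * (delta / (expR pi + 1)) <= D.
  apply: le_trans spread; rewrite ler_wpM2l//.
  have e1 := expR_ge1Dx delta; have e2 : expR delta <= expR pi by rewrite ler_expR.
  have e0 := expR_gt0 delta.
  apply: ler_pM; rewrite ?(ltW d0) ?invr_ge0 ?lef_pV2 ?posrE; lra.
have H0 : 0 <= n%:R * (delta / (expR pi + 1)).
  by rewrite mulr_ge0// divr_ge0 ?(ltW d0)// addr_ge0 ?expR_ge0.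
have S0 : 0 <= pi / delta * y by rewrite !mulr_ge0 ?invr_ge0 ?(ltW y0) ?(ltW pi0) ?(ltW d0).
have DS := ler_pM H0 S0 Dl S.
move=> DI.
have I0 : 0 <= I.
  have : 0 <= I * (E - E^-1) by apply: le_trans DI; apply: le_trans DS; exact: mulr_ge0.
  by rewrite pmulr_lge0// subr_gt0.
have IE : n%:R * (delta / (expR pi + 1)) * (pi / delta * y) <= I * E.
  apply: le_trans (le_trans DS DI) _; rewrite ler_wpM2l//; lra.
have -> : decay_rate * y = n%:R * (delta / (expR pi + 1)) * (pi / delta * y) / E.
  rewrite /decay_rate /E expRN (expRD (2 * pi / delta * ln rho)).
  have e0 := expR_gt0 (pi : R); have e2 := expR_gt0 (2 * pi : R).
  have e3 := expR_gt0 (2 * pi / delta * ln rho).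
  move: (expR pi) (expR (2 * pi)) (expR (2 * pi / delta * ln rho)) e0 e2 e3 => x u v x0 u0 v0.
  by field; rewrite !gt_eqF//; lra.
by rewrite ler_pdivrMr.
Qed.

(** [Im_mu_lower] says that |g(iy)|^2 exp(decay_rate y^2) is nonincreasing, and its
    value at 0 is 1. *)
Lemma epoly_decay (y : R) : 0 <= y <= delta / 8 ->
  cabs (epoly p (0 +i* y)) ^+ 2 <= expR (- (decay_rate * y ^+ 2)).
Proof.
move=> /andP[y0 yd]; have d_gt0 := d0.
pose S (s : R) := cabs (epoly p (0 + s%:C * 'i)) ^+ 2.
have iE (s : R) : 0 + s%:C * 'i = 0 +i* s :> R[i].
  by apply/eqP; rewrite eq_complex /=; apply/andP; split; apply/eqP; ring.
pose G (s : R) := expR (decay_rate * (s * s)).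
pose dG (s : R) := G s * (decay_rate * (2 * s)).
pose dS (s : R) := - 2 * S s * complex.Im (mu p (0 +i* s)).
have nz (s : R) : `|s| < delta -> epoly p (0 +i* s) != 0.
  by rewrite ltr_norml => h; exact: p_nz.
have DS (s : R) : `|s| < delta -> is_derive s 1 S (dS s).
  move=> /nz; rewrite -iE => /is_derive_abs2_vertical.
  by rewrite /dS /S /mu iE.
have DG (s : R) : is_derive s 1 G (dG s).
  have h : is_derive s 1 (cst decay_rate * (id * id)) (decay_rate * (2 * s)).
    apply: is_derive_eq; rewrite /GRing.scale /= !fctE; ring.
  exact: (is_derive_chain h (is_derive_expR _)).
have DSG (s : R) : `|s| < delta -> is_derive s 1 (S * G) (S s * dG s + G s * dS s).
  by move=> sd; have h := DS s sd; have h' := DG s; apply: is_derive_eq.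
have [||c /[!in_itv]/= /andP[c0 cy]] :=
  @MVT_segment R (S * G) (fun s => S s * dG s + G s * dS s) 0 y y0.
- move=> x; rewrite in_itv /= => /andP[x0 xy]; apply: DSG.
  by rewrite ger0_norm ?ltW//; lra.
- apply: derivable_within_continuous => x; rewrite in_itv /= => /andP[x0 xy].
  by have [] := DSG x; first by rewrite ger0_norm//; lra.
rewrite subr0 => E.
have S1 : S 0 = 1.
  by rewrite /S mul0r addr0 /epoly cexp0 p1 cabs1 expr1n.
have SGc : S c * dG c + G c * dS c <= 0.
  have [->|cn0] := eqVneq c 0.
    have i0 := @mu_real _ p p_ge0 0.
    have -> : dS 0 = 0.
      rewrite /dS (_ : 0 +i* 0 = (0 : R)%:C)// i0 mulr0 //.
    by rewrite /dG !mulr0 addr0.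
  have c_gt0 : 0 < c by rewrite lt_def cn0.
  have Im_c : decay_rate * c <= complex.Im (mu p (0 +i* c)).
    by apply: Im_mu_lower; rewrite c_gt0 (le_trans cy).
  have -> : S c * dG c + G c * dS c =
      2 * (S c * G c) * (decay_rate * c - complex.Im (mu p (0 +i* c))).
    by rewrite /dG /dS; ring.
  have Sc0 : 0 <= S c by rewrite exprn_ge0 ?cabs_ge0.
  have Gc0 : 0 <= G c by exact: expR_ge0.
  by rewrite mulr_ge0_le0 ?subr_le0// mulr_ge0// mulr_ge0.
have : S y * G y - S 0 * G 0 <= 0.
  by rewrite [leLHS]E; exact: mulr_le0_ge0 SGc y0.
rewrite S1 /G !mul0r mulr0 expR0 mulr1 subr_le0 -expr2.
by rewrite /S iE expRN -div1r ler_pdivlMr ?expR_gt0.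
Qed.

End Decay.

(** * Bounding coefficients by the Fejer kernel *)

Section Fejer.
Variable R : realType.
Implicit Types (p : {poly R[i]}) (x t : R) (r : R).

Definition unitc x : R[i] := cexp (0 +i* x).

Lemma unitcD x t : unitc (x + t) = unitc x * unitc t.
Proof. by rewrite -cexpD; congr cexp; apply/eqP; rewrite eq_complex /= addr0 !eqxx. Qed.

Lemma unitcMn (k : nat) x : unitc (k%:R * x) = unitc x ^+ k.
Proof.
elim: k => [|k IH]; last by rewrite -natr1 mulrDl mul1r unitcD IH exprSr.
by rewrite mul0r /unitc (_ : 0 +i* 0 = 0) ?cexp0.
Qed.

Lemma unitcN x : unitc (- x) = conjc (unitc x).
Proof. by rewrite conj_cexp /= . Qed.

Lemma cabs_unitc x : cabs (unitc x) = 1.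
Proof. by rewrite cabs_cexp /= expR0. Qed.

(** Expand p on the right-hand side without absolute values, after twisting by
    e^(- i y t): the coefficient p`_k gets multiplied by |D_k|^2 >= 0 with
    D_k = sum_j e^(i (k - y) j h), and D_y = N. *)
Lemma coef_le_fejer p (y N : nat) (h : R) : (forall i, 0 <= p`_i) ->
  cabs p`_y * N%:R ^+ 2 <=
  \sum_(j < N) \sum_(l < N) cabs (epoly p (0 +i* ((j%:R - l%:R) * h))).
Proof.
move=> p_ge0.
pose c (k : nat) (j : nat) := unitc ((k%:R - y%:R) * (j%:R * h)).
have cE (k j l : nat) : c k j * conjc (c k l) =
    unitc (- (y%:R * ((j%:R - l%:R) * h))) * unitc ((j%:R - l%:R) * h) ^+ k.
  rewrite -unitcN -unitcD -unitcMn -unitcD; congr unitc; ring.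
pose D (k : nat) := \sum_(j < N) c k j.
pose S := \sum_(j < N) \sum_(l < N)
  unitc (- (y%:R * ((j%:R - l%:R) * h))) * epoly p (0 +i* ((j%:R - l%:R) * h)).
have SE : S = \sum_(k < size p) p`_k * (D k * conjc (D k)).
  transitivity (\sum_(j < N) \sum_(l < N) \sum_(k < size p)
      p`_k * (c k j * conjc (c k l))).
    apply: eq_bigr => j _; apply: eq_bigr => l _.
    rewrite /epoly horner_coef mulr_sumr; apply: eq_bigr => k _.
    by rewrite cE mulrCA.
  under eq_bigr do rewrite exchange_big /=.
  rewrite exchange_big /=; apply: eq_bigr => k _.
  rewrite /D rmorph_sum /= mulr_suml mulr_sumr; apply: eq_bigr => j _.
  by rewrite mulr_sumr mulr_sumr.
have S_ge : p`_y * N%:R ^+ 2 <= S.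
  have [ysz|ysz] := ltnP y (size p); last first.
    rewrite nth_default// mul0r SE sumr_ge0// => k _.
    by rewrite mulr_ge0// mulcJ_ge0.
  rewrite SE (bigD1 (Ordinal ysz))//= -[leLHS]addr0 lerD//; last first.
    by rewrite sumr_ge0// => k _; rewrite mulr_ge0// mulcJ_ge0.
  have -> : D y = N%:R.
    rewrite /D (eq_bigr (fun=> 1)); first by rewrite sumr_const card_ord.
    by move=> j _; rewrite /c subrr mul0r /unitc (_ : 0 +i* 0 = 0) ?cexp0.
  by rewrite conjc_nat expr2.
have S0 : 0 <= p`_y * N%:R ^+ 2 by rewrite mulr_ge0// exprn_ge0// ler0n.
have : `|p`_y * N%:R ^+ 2| <= `|S|.
  by rewrite !ger0_norm// (le_trans S0).
have cN : cabs (N%:R : R[i]) = N%:R.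
  by rewrite -(rmorph_nat (real_complex R)) cabs_real ger0_norm// ler0n.
rewrite !norm_cabs lecR cabsM cabsX cN => /le_trans; apply.
have sum_le (I : finType) (f : I -> R[i]) : cabs (\sum_i f i) <= \sum_i cabs (f i).
  elim/big_ind2 : _ => [|u u' v v' h1 h2|//]; first by rewrite cabs0.
  by apply: le_trans (cabsD _ _) _; exact: lerD.
apply: le_trans (sum_le _ _) _; apply: ler_sum => j _.
apply: le_trans (sum_le _ _) _; apply: ler_sum => l _.
by rewrite cabsM cabs_unitc mul1r.
Qed.

Lemma geo_sum_le r (m : nat) : 0 <= r < 1 -> \sum_(i < m) r ^+ i <= (1 - r)^-1.
Proof.
move=> /andP[r0 r1]; have r1' : 0 < 1 - r by rewrite subr_gt0.
rewrite -[leRHS]mul1r ler_pdivlMr// mulrC.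
have -> : (1 - r) * (\sum_(i < m) r ^+ i) = 1 - r ^+ m.
  by rewrite -[in RHS](expr1n _ m) subrXX; congr (_ * _); apply: eq_bigr => i _; rewrite expr1n mul1r.
by rewrite gerBl exprn_ge0.
Qed.

(** The exponent is |j - l|, as one of the two truncated differences vanishes. *)
Lemma two_sided_geo_sum_le r (j N : nat) : 0 <= r < 1 ->
  \sum_(l < N) r ^+ ((j - l) + (l - j)) <= 2 * (1 - r)^-1.
Proof.
move=> r01; have /andP[r0 r1] := r01.
have left_sum (m : nat) : (m <= j)%N -> \sum_(l < m) r ^+ ((j - l) + (l - j)) <= (1 - r)^-1.
  move=> mj; apply: le_trans (geo_sum_le j.+1 r01).
  rewrite -(big_mkord xpredT (fun i => r ^+ i)) big_nat_rev /= add0n.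
  rewrite -(big_mkord xpredT (fun l => r ^+ ((j - l) + (l - j)))).
  rewrite [leRHS](big_cat_nat (n := m)) ?(leq_trans mj)//= -[leLHS]addr0 lerD//.
    rewrite !big_mkord; apply: ler_sum => l _.
    have lj : (l <= j)%N by rewrite ltnW// (leq_trans (ltn_ord l)).
    by rewrite subSS (eqP lj) addn0.
  by rewrite sumr_ge0// => i _; rewrite exprn_ge0.
have [Nj|jN] := leqP N j.
  by apply: le_trans (left_sum N Nj) _; rewrite ler_peMl ?ler1n// invr_ge0 subr_ge0 ltW.
rewrite -(big_mkord xpredT (fun l => r ^+ ((j - l) + (l - j)))).
rewrite (big_cat_nat (n := j)) ?(ltnW jN)//= mulr_natl mulr2n lerD//.
  by rewrite big_mkord; exact: left_sum.
rewrite -{1}[j]add0n big_addn big_mkord; apply: le_trans (geo_sum_le (N - j) r01).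
apply: ler_sum => l _; rewrite addnK.
by have /eqP -> : (j - (l + j) == 0)%N by rewrite subn_eq0 leq_addl.
Qed.

Lemma coef_le1 p (y : nat) : (forall i, 0 <= p`_i) -> p.[1] = 1 -> cabs p`_y <= 1.
Proof.
move=> p_ge0 p1; rewrite -lecR -norm_cabs ger0_norm// -[leRHS]p1 horner_coef.
under eq_bigr do rewrite expr1n mulr1.
have [ysz|ysz] := ltnP y (size p); last by rewrite nth_default// sumr_ge0.
by rewrite (bigD1 (Ordinal ysz))//= lerDl sumr_ge0.
Qed.

(** Take N points at spacing b / N with N just above B = b sqrt(A / 2).  Then the
    Gaussian exponent at distance k is at least k^2 / 4 >= k / 4, so the Fejer average
    is dominated by a two-sided geometric series.  If B < 1 the bound exceeds 1. *)
Lemma coef_gauss_bound p (A b : R) (y : nat) : (forall i, 0 <= p`_i) -> p.[1] = 1 ->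
  0 < A -> 0 < b ->
  (forall t : R, 0 <= t <= b ->
     cabs (epoly p (0 +i* t)) ^+ 2 <= expR (- (A * t ^+ 2))) ->
  cabs p`_y <= 2 * (1 - expR (- (1 / 4)))^-1 / (b * Num.sqrt (A / 2)).
Proof.
move=> p_ge0 p1 A0 b0 decay; set r := expR _; set c2 := 2 * _; set B := b * _.
have r01 : 0 <= r < 1 by rewrite expR_ge0 expR_lt1 oppr_lt0 divr_gt0.
have /andP[r0 r1] := r01.
have c21 : 1 <= c2.
  have r1' : 0 < 1 - r by rewrite subr_gt0.
  rewrite /c2 -(@ler_pM2r _ (1 - r))// -mulrA mulVf ?gt_eqF//; lra.
have B0 : 0 < B by rewrite mulr_gt0// sqrtr_gt0 divr_gt0.
have [B1|B1] := ltP B 1.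
  apply: le_trans (coef_le1 y p_ge0 p1) _.
  by rewrite ler_pdivlMr// mul1r (le_trans (ltW B1)).
pose N := (Num.truncn B).+1.
have /andP[N1 N2] := truncn_itv (ltW B0).
have N0 : 0 < N%:R :> R by rewrite ltr0n.
have NB : N%:R <= 2 * B by rewrite /N -natr1; lra.
apply: (@le_trans _ _ (c2 / N%:R)); last first.
  by rewrite ler_pM2l ?(lt_le_trans _ c21)// lef_pV2 ?posrE// ltW.
rewrite ler_pdivlMr// -(@ler_pM2r _ N%:R)// -mulrA -expr2.
apply: le_trans (coef_le_fejer y N (b / N%:R) p_ge0) _.
have -> : c2 * N%:R = \sum_(j < N) c2 by rewrite sumr_const card_ord mulr_natr.
apply: ler_sum => j _; apply: le_trans (two_sided_geo_sum_le j N r01).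
apply: ler_sum => l _; set k := ((j - l) + (l - j))%N.
have kE : `|j%:R - l%:R| = k%:R :> R.
  have [jl|lj] := leqP j l.
    by rewrite distrC /k (eqP jl) add0n natrB// ger0_norm// subr_ge0 ler_nat.
  rewrite /k natrD natrB ?(ltnW lj)//; have /eqP -> := ltnW lj.
  by rewrite addr0 ger0_norm// subr_ge0 ler_nat ltnW.
have kN : (k <= N)%N.
  rewrite /k; have [jl|lj] := leqP j l.
    by rewrite (eqP jl) add0n (leq_trans (leq_subr _ _))// ltnW.
  by have /eqP -> := ltnW lj; rewrite addn0 (leq_trans (leq_subr _ _))// ltnW.
set t := _ * (b / N%:R).
have tE : `|t| = k%:R * (b / N%:R).
  by rewrite normrM kE ger0_norm// divr_ge0// ltW.
have tb : 0 <= `|t| <= b.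
  rewrite normr_ge0 tE /= mulrCA ler_piMr ?(ltW b0)//.
  by rewrite ler_pdivrMr// mul1r ler_nat.
have -> : cabs (epoly p (0 +i* t)) = cabs (epoly p (0 +i* `|t|)).
  have [t0|t0] := ger0P t => //.
  by rewrite -cabs_epoly_conj//= .
rewrite -ler_sqr ?nnegrE ?cabs_ge0 ?exprn_ge0//.
apply: le_trans (decay _ tb) _.
rewrite -exprM -expRM_natl ler_expR mulrN lerN2 tE.
have B2 : B ^+ 2 = b ^+ 2 * (A / 2).
  by rewrite exprMn sqr_sqrtr// ltW// divr_gt0.
have -> : A * (k%:R * (b / N%:R)) ^+ 2 = k%:R ^+ 2 * (2 * (B / N%:R) ^+ 2).
  by rewrite [(B / _) ^+ 2]exprMn B2; field; rewrite gt_eqF.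
have h1 : 1 / 2 <= B / N%:R by rewrite ler_pdivlMr//; lra.
have h2 : 1 / 2 <= 2 * (B / N%:R) ^+ 2 by nra.
have h3 : (k%:R : R) <= k%:R ^+ 2 by rewrite -natrX ler_nat; case: (k) => // m; rewrite expnS leq_pmulr ?expn_gt0.
have h4 : 0 <= k%:R :> R by rewrite ler0n.
rewrite natrM mulrAC -mulrA.
have -> : (k%:R * (1 / 4 * 2) : R) = k%:R * (1 / 2) by field.
by apply: ler_pM.
Qed.

End Fejer.

(** * Probability generating functions and the theorem *)

Section PgfFacts.

Lemma pgf_coef d (T : measurableType d) (R : realType) (P : probability T R)
    (X : {RV P >-> R}) (n k : nat) :
  (pgf X n)`_k = if (k < n.+1)%N then (pmf X k%:R)%:C else 0.
Proof. by rewrite /pgf coef_poly. Qed.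

Lemma pgf_coef_ge0 d (T : measurableType d) (R : realType) (P : probability T R)
    (X : {RV P >-> R}) (n k : nat) : 0 <= (pgf X n)`_k.
Proof. by rewrite pgf_coef; case: ifP => // _; rewrite lecR pmf_ge0. Qed.

Lemma size_pgf d (T : measurableType d) (R : realType) (P : probability T R)
    (X : {RV P >-> R}) (n : nat) : 0 < pmf X n%:R -> size (pgf X n) = n.+1.
Proof.
by move=> Xn; rewrite /pgf size_poly_eq// (inj_eq (@complexI R)) gt_eqF.
Qed.

Lemma sum_pmf d (T : measurableType d) (R : realType) (P : probability T R)
    (X : {RV P >-> R}) (n : nat) :
  (forall w : T, exists2 k : nat, (k <= n)%N & X w = k%:R) ->
  \sum_(k < n.+1) pmf X k%:R = 1.
Proof.
move=> Xn; apply: EFin_inj; rewrite -sumEFin.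
pose F (k : nat) := X @^-1` [set k%:R].
have mF (k : nat) : measurable (F k).
  by rewrite /F -[X in measurable X]setTI; exact: measurable_funP.
have tF : trivIset setT F.
  apply/trivIsetP => i j _ _ ij; apply/seteqP; split => // w [/= Xi Xj].
  by move: ij; rewrite -(eqr_nat R) -Xi -Xj eqxx.
transitivity (\sum_(k < n.+1) P (F k))%E.
  by apply: eq_bigr => k _; rewrite /pmf fineK// fin_num_measure.
rewrite -(measure_bigsetU P mF tF) -(@probability_setT _ _ _ P); congr (P _).
rewrite -bigcup_mkord; apply/seteqP; split => // w _.
by have [k kn Xk] := Xn w; exists k.
Qed.

End PgfFacts.

Theorem corollary4 (R : realType) :
  exists2 c : R, 0 < c &
    forall (d : measure_display) (T : measurableType d) (P : probability T R)
      (n : nat) (X : {RV P >-> R}) (delta rho : R),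
      (1 <= n)%N ->
      (forall w : T, exists2 k : nat, (k <= n)%N & X w = k%:R) ->
      0 < pmf X 0 * pmf X n%:R ->
      0 < delta ->
      1 <= rho ->
      (forall zeta : R[i], root (pgf X n) zeta ->
         (forall t : R, is_arg zeta t -> delta <= `|t|) /\
         (rho^-1)%:C <= `|zeta| <= rho%:C) ->
      \big[Num.max/0]_(y < n.+1) pmf X y%:R <=
        c * delta^-1 * rho `^ (pi / delta) * n%:R `^ (- 2^-1).
Proof.
pose c1 : R := pi / ((expR pi + 1) * expR (2 * pi)).
pose c2 : R := 2 * (1 - expR (- (1 / 4)))^-1.
have c1_gt0 : 0 < c1.
  by rewrite divr_gt0 ?pi_gt0// mulr_gt0 ?expR_gt0// addr_gt0 ?expR_gt0.
have c2_gt0 : 0 < c2.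
  by rewrite mulr_gt0// invr_gt0 subr_gt0 expR_lt1 oppr_lt0 divr_gt0.
have s1_gt0 : 0 < Num.sqrt (c1 / 2) by rewrite sqrtr_gt0 divr_gt0.
exists (c2 * 8 / Num.sqrt (c1 / 2)); first by rewrite divr_gt0// mulr_gt0.
move=> d T P n X delta rho n1 Xn X0n d0 rho1 zeros.
have rho0 : 0 < rho by apply: lt_le_trans rho1.
have Xn_gt0 : 0 < pmf X n%:R.
  rewrite lt_def pmf_ge0 andbT; apply: contraTN X0n => /eqP ->.
  by rewrite mulr0 ltxx.
have size_p := size_pgf Xn_gt0.
have p_ge0 := pgf_coef_ge0 X n.
have p1 : (pgf X n).[1] = 1.
  rewrite horner_coef size_p.
  under eq_bigr => k _ do rewrite expr1n mulr1 pgf_coef ltn_ord.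
  by rewrite -(rmorph_sum (real_complex R)) sum_pmf.
have p_ann z : root (pgf X n) z -> rho^-1 <= cabs z <= rho.
  by move=> /zeros[_]; rewrite norm_cabs !lecR.
(* As n >= 1 there is a zero, and its argument is at most pi in absolute value. *)
have dpi : delta <= pi.
  have /closed_rootP[z rz] : size (pgf X n) != 1 by rewrite size_p eqSS -lt0n.
  have z0 : z != 0.
    rewrite -cabs_gt0; have /andP[+ _] := p_ann z rz.
    by apply: lt_le_trans; rewrite invr_gt0.
  have [t tz] := is_arg_exists z0; have [/(_ t tz) dt _] := zeros z rz.
  by apply: le_trans dt _; rewrite ler_norml; case: tz.
have p_nz w : strip (- delta) delta w -> epoly (pgf X n) w != 0.
  rewrite /strip /= -ltr_norml => wd; apply/negP => /zeros[H _].
  have : is_arg (cexp w) (complex.Im w).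
    split; first by rewrite -ler_norml (le_trans (ltW wd)).
    by exists (expR (complex.Re w)); first exact: expR_gt0.
  by move=> /H; rewrite leNgt wd.
have decay := epoly_decay p_ge0 size_p d0 dpi rho1 p_nz p_ann p1.
set A := decay_rate n rho delta in decay.
have n0 : 0 < n%:R :> R by rewrite ltr0n.
have A0 : 0 < A by rewrite /A /decay_rate -/c1 mulr_gt0 ?expR_gt0// mulr_gt0.
have b0 : 0 < delta / 8 by rewrite divr_gt0.
have sqrtA : Num.sqrt (A / 2) =
    Num.sqrt n%:R * Num.sqrt (c1 / 2) * expR (- (pi / delta * ln rho)).
  have -> : A / 2 = n%:R * (c1 / 2) * expR (- (pi / delta * ln rho)) ^+ 2.
    rewrite -expRM_natl /A /decay_rate -/c1 mulrN.
    have -> : 2%:R * (pi / delta * ln rho) = 2 * pi / delta * ln rho by ring.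
    by ring.
  have c12 : 0 <= c1 / 2 by rewrite divr_ge0 ?ltW.
  rewrite sqrtrM; last by apply: mulr_ge0 c12; rewrite ltW.
  by rewrite sqrtr_sqr ger0_norm ?expR_ge0// sqrtrM ?(ltW n0).
have -> : c2 * 8 / Num.sqrt (c1 / 2) * delta^-1 * rho `^ (pi / delta) *
    n%:R `^ (- 2^-1) = c2 / (delta / 8 * Num.sqrt (A / 2)).
  rewrite sqrtA [expR (- _)]expRN [n%:R `^ (- _)]powRN -(powR12_sqrt (ltW n0)).
  have -> : rho `^ (pi / delta) = expR (pi / delta * ln rho).
    by rewrite [_ * ln rho]mulrC expRM lnK ?posrE.
  have e0 : expR (pi / delta * ln rho) != 0 by rewrite gt_eqF ?expR_gt0.
  have p0 : n%:R `^ 2^-1 != 0 :> R by rewrite gt_eqF ?powR_gt0.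
  move: (expR _) (n%:R `^ _) (Num.sqrt _) (lt0r_neq0 s1_gt0) e0 p0 => u v s s0 u0 v0.
  by field; rewrite u0 v0 s0 gt_eqF.
apply: bigmax_le => [|y _].
  by rewrite divr_ge0 ?(ltW c2_gt0)// mulr_ge0 ?(ltW b0)// sqrtr_ge0.
have -> : pmf X y%:R = cabs (pgf X n)`_y.
  by rewrite pgf_coef ltn_ord cabs_real ger0_norm// pmf_ge0.
exact: coef_gauss_bound decay.
Qed.
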